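(* Every compact convex polyhedron $P\subset\mathbb{R}^3$ (with non-empty interior) is infinitesimally rigid, that is, every isometric infinitesimal deformation of $P$ is trivial.
   Context: Let $P\subset\mathbb{R}^3$ be a compact convex polyhedron with non-empty interior and vertices $p_1,\dots,p_n$. An infinitesimal deformation of $P$ is a collection of vectors $q_1,\dots,q_n\in\mathbb{R}^3$ ($q_i$ is thought of as applied at $p_i$). If all faces of $P$ are triangles, the deformation $(q_i)$ is called isometric if $\frac{d}{dt}\big|_{t=0}\|(p_i+tq_i)-(p_j+tq_j)\|=0$ for all edges $p_ip_j$ of $P$; equivalently $\langle p_i-p_j,q_i-q_j\rangle=0$ for all edges. If $P$ has non-triangular faces, each such face is first subdivided into triangles by non-crossing diagonals (without adding vertices), and the condition $\frac{d}{dt}\big|_{t=0}\|(p_i+tq_i)-(p_j+tq_j)\|=0$ (equivalently $\langle p_i-p_j,q_i-q_j\rangle=0$) is required for all edges $p_ip_j$ of $P$ and also for all subdividing diagonals $p_ip_j$. The deformation $(q_i)$ is called trivial if there are $A\in\mathfrak{so}(3)$ and $b\in\mathbb{R}^3$ with $q_i=Ap_i+b$ for all $i$. *)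

(* Defs.v *)
From HB Require Import structures.
From mathcomp Require Import all_boot all_order all_algebra.
From mathcomp Require Import all_classical all_reals all_analysis.

Set Implicit Arguments.
Unset Strict Implicit.
Unset Printing Implicit Defensive.

Import Order.TTheory GRing.Theory Num.Theory.
Import numFieldNormedType.Exports.

Local Open Scope classical_set_scope.
Local Open Scope ring_scope.

Definition dot (R : realType) (u v : 'cV[R]_3) : R :=
  \sum_(i < 3) u i 0 * v i 0.

(* The norm `|u| of the library on matrices is the sup norm. *)
Definition enorm (R : realType) (u : 'cV[R]_3) : R := Num.sqrt (dot u u).

Definition segment (R : realType) (a b : 'cV[R]_3) : set 'cV[R]_3 :=
  [set x | exists t : R, [/\ 0 <= t, t <= 1 & x = (1 - t) *: a + t *: b]].

Definition open_segment (R : realType) (a b : 'cV[R]_3) : set 'cV[R]_3 :=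
  [set x | exists t : R, [/\ 0 < t, t < 1 & x = (1 - t) *: a + t *: b]].

Definition triangle (R : realType) (a b c : 'cV[R]_3) : set 'cV[R]_3 :=
  [set x | exists r s t : R,
    [/\ 0 <= r, 0 <= s, 0 <= t, r + s + t = 1 & x = r *: a + s *: b + t *: c]].

Definition noncollinear (R : realType) (a b c : 'cV[R]_3) : Prop :=
  free [:: b - a; c - a].

Definition convex_polyhedron (R : realType) (P : set 'cV[R]_3) : Prop :=
  exists (m : nat) (u : 'I_m -> 'cV[R]_3) (c : 'I_m -> R),
    (forall k, u k != 0) /\ P = [set x | forall k, dot (u k) x <= c k].

(* Proper faces, of any dimension: intersections with a supporting plane.
   Vertices, edges and facets are the faces of dimension 0, 1 and 2. *)
Definition proper_face (R : realType) (P F : set 'cV[R]_3) : Prop :=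
  exists (u : 'cV[R]_3) (c : R),
    [/\ u != 0, forall x, P x -> dot u x <= c
      & F = P `&` [set x | dot u x = c]].

Definition is_vertex (R : realType) (P : set 'cV[R]_3) (x : 'cV[R]_3) : Prop :=
  proper_face P [set x].

Definition is_edge (R : realType) (P : set 'cV[R]_3) (x y : 'cV[R]_3) : Prop :=
  x <> y /\ proper_face P (segment x y).

Definition is_facet (R : realType) (P F : set 'cV[R]_3) : Prop :=
  proper_face P F /\
  exists a b c, [/\ F a, F b, F c & noncollinear a b c].

Definition enumerates_vertices (R : realType) (P : set 'cV[R]_3)
    (n : nat) (p : 'I_n -> 'cV[R]_3) : Prop :=
  injective p /\ range p = [set x | is_vertex P x].

Definition is_diagonal (R : realType) (P F : set 'cV[R]_3)
    (x y : 'cV[R]_3) : Prop :=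
  [/\ is_vertex P x, is_vertex P y, F x, F y & x <> y /\ ~ is_edge P x y].

(* D is the set of subdividing diagonals of all the facets, as a relation on
   indices of vertices. A triangular facet has no diagonal, so it needs no
   separate treatment. *)
Definition subdivides_faces (R : realType) (P : set 'cV[R]_3)
    (n : nat) (p : 'I_n -> 'cV[R]_3) (D : rel 'I_n) : Prop :=
  [/\ symmetric D,
      forall i j, D i j ->
        exists2 F, is_facet P F & is_diagonal P F (p i) (p j),
      forall F i j k l, is_facet P F ->
        F (p i) -> F (p j) -> F (p k) -> F (p l) -> D i j -> D k l ->
        segment (p i) (p j) = segment (p k) (p l) \/
        open_segment (p i) (p j) `&` open_segment (p k) (p l) = set0
    & forall F x, is_facet P F -> F x ->
        exists i j k,
          [/\ [/\ F (p i), F (p j) & F (p k)],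
              noncollinear (p i) (p j) (p k),
              [/\ is_edge P (p i) (p j) \/ D i j,
                  is_edge P (p j) (p k) \/ D j k
                & is_edge P (p k) (p i) \/ D k i]
            & triangle (p i) (p j) (p k) x]].

Definition isometric_deformation (R : realType) (P : set 'cV[R]_3)
    (n : nat) (p : 'I_n -> 'cV[R]_3) (D : rel 'I_n)
    (q : 'I_n -> 'cV[R]_3) : Prop :=
  forall i j, is_edge P (p i) (p j) \/ D i j ->
    is_derive (0 : R) (1 : R)
      (fun t : R => enorm ((p i + t *: q i) - (p j + t *: q j))) 0.

Definition trivial_deformation (R : realType)
    (n : nat) (p q : 'I_n -> 'cV[R]_3) : Prop :=
  exists (A : 'M[R]_3) (b : 'cV[R]_3),
    A^T = - A /\ forall i, q i = A *m p i + b.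

Definition infinitesimally_rigid (R : realType) (P : set 'cV[R]_3)
    (n : nat) (p : 'I_n -> 'cV[R]_3) (D : rel 'I_n) : Prop :=
  forall q : 'I_n -> 'cV[R]_3,
    isometric_deformation P p D q -> trivial_deformation p q.

(* Main.v *)
Require Import Defs.
From HB Require Import structures.
From mathcomp Require Import all_boot all_order all_algebra.
From mathcomp Require Import all_classical all_reals all_analysis.
From mathcomp Require Import ring lra.
Import Order.TTheory GRing.Theory Num.Theory.
Import numFieldNormedType.Exports.
Local Open Scope classical_set_scope.
Local Open Scope ring_scope.

(** A discrete form of Blaschke's rigidity argument.  Put the origin at an
    interior point and let [f i = <q_i, p_i>].  Every triangle moves with a
    velocity [x |-> cross w x + v], and [v] is the gradient of the
    function that is linear on the cone over the triangle and equal to [f] at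
    its vertices.  Across an edge [p_i p_j] the vectors [v] and [w] jump by
    [lam_ij (cross p_i p_j)] and [lam_ij (p_j - p_i)], so [lam] is a symmetric
    self-stress.  The infinitesimal Minkowski inequality for the polygon dual to
    the vertex [p_i] shows [Q_i = sum_j lam_ij (f_j - f_i) <= 0]; the sum of the
    [Q_i] vanishes by antisymmetry, so every [Q_i] is zero, and the equality
    case says that [v] is the same for all triangles at [p_i], hence for all
    triangles.  As this holds for every interior origin, the motions of all
    triangles agree. *)

Set Implicit Arguments.
Unset Strict Implicit.
Unset Printing Implicit Defensive.

(** * Vectors in three-space *)

Section Coordinates.
Variable R : realType.
Local Notation V := 'cV[R]_3.
Implicit Types (a b c u v : V).

Local Notation i0 := (@Ordinal 3 0 isT).
Local Notation i1 := (@Ordinal 3 1 isT).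
Local Notation i2 := (@Ordinal 3 2 isT).

(** [subdivides_faces] provides covering triangles with non-crossing sides, not a combinatorial
    surface. That a side belongs to exactly two triangles, and that the triangles at a vertex close
    up, is drawn from two facts on the cones over the triangles: they cover space ([T_cover]), and a
    linear dependency with its positive part on one triangle and its negative part on another is
    zero ([T_fan]). Summation by parts around a vertex then rests on unique successors and
    predecessors, and the passage from one vertex to all others is a maximum argument. In the
    inequality at [p_i] the Jacobi quotient by [h] degenerates along the directions [e] and [- e],
    where [h] vanishes. So [f] is corrected to have zero derivative along both: a linear function
    settles one direction, and the other needs [psi], which is zero at [p_i] and positive at all
    other vertices. Such a [psi] exists because [p_i] is exposed; the edges at [p_i] alone could not
    provide it with strict signs, as diagonals of a facet are flat. *)

Definition cross u v : V :=
  \col_(i < 3) match val i with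
    | 0 => u i1 0 * v i2 0 - u i2 0 * v i1 0
    | 1 => u i2 0 * v i0 0 - u i0 0 * v i2 0
    | _ => u i0 0 * v i1 0 - u i1 0 * v i0 0
    end.

Definition triple a b c : R := dot a (cross b c).

Lemma dotE u v : dot u v = u i0 0 * v i0 0 + u i1 0 * v i1 0 + u i2 0 * v i2 0.
Proof.
rewrite /dot !big_ord_recl big_ord0 addr0 addrA.
by congr (_ * _ + _ * _ + _ * _); congr (fun_of_matrix _ _ _); apply: val_inj.
Qed.

Lemma vec3P u v :
  u i0 0 = v i0 0 -> u i1 0 = v i1 0 -> u i2 0 = v i2 0 -> u = v.
Proof.
move=> h0 h1 h2; apply/colP => -[[|[|[|//]]] hi].
- by rewrite (_ : Ordinal hi = i0) //; apply: val_inj.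
- by rewrite (_ : Ordinal hi = i1) //; apply: val_inj.
- by rewrite (_ : Ordinal hi = i2) //; apply: val_inj.
Qed.

End Coordinates.

Ltac vring := rewrite /triple ?dotE /cross ?mxE /=; ring.
Ltac vecring := apply: vec3P; rewrite /triple ?dotE /cross !mxE /=; ring.

Section Space.
Variable R : realType.
Local Notation V := 'cV[R]_3.
Implicit Types (a b c d u v w x y z : V) (s t : R).

Lemma dotC u v : dot u v = dot v u. Proof. vring. Qed.
Lemma dotDl u v w : dot (u + v) w = dot u w + dot v w. Proof. vring. Qed.
Lemma dotDr u v w : dot w (u + v) = dot w u + dot w v. Proof. vring. Qed.
Lemma dotNl u v : dot (- u) v = - dot u v. Proof. vring. Qed.
Lemma dotNr u v : dot u (- v) = - dot u v. Proof. vring. Qed.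
Lemma dotBl u v w : dot (u - v) w = dot u w - dot v w. Proof. vring. Qed.
Lemma dotBr u v w : dot w (u - v) = dot w u - dot w v. Proof. vring. Qed.
Lemma dotZl s u v : dot (s *: u) v = s * dot u v. Proof. vring. Qed.
Lemma dotZr s u v : dot u (s *: v) = s * dot u v. Proof. vring. Qed.
Lemma dot0l v : dot 0 v = 0. Proof. vring. Qed.
Lemma dot0r v : dot v 0 = 0. Proof. vring. Qed.
Lemma dot_ge0 u : 0 <= dot u u.
Proof. by rewrite dotE -!expr2 !addr_ge0 ?sqr_ge0. Qed.

Lemma dot_eq0 u : (dot u u == 0) = (u == 0).
Proof.
apply/eqP/eqP => [|->]; last exact: dot0l.
rewrite dotE => h; apply: vec3P; rewrite mxE; nra.
Qed.

Lemma dot_gt0 u : u != 0 -> 0 < dot u u.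
Proof. by move=> u0; rewrite lt_def dot_eq0 u0 dot_ge0. Qed.

Lemma dot_suml (I : Type) (r : seq I) (A : pred I) (F : I -> V) v :
  dot (\sum_(i <- r | A i) F i) v = \sum_(i <- r | A i) dot (F i) v.
Proof.
rewrite (@big_morph _ _ (fun u => dot u v) 0 +%R 0 +%R) // => [x y|].
  exact: dotDl.
exact: dot0l.
Qed.

Lemma dot_sumr (I : Type) (r : seq I) (A : pred I) (F : I -> V) v :
  dot v (\sum_(i <- r | A i) F i) = \sum_(i <- r | A i) dot v (F i).
Proof. by rewrite dotC dot_suml; apply: eq_bigr => i _; rewrite dotC. Qed.

Lemma dot_ext u v : (forall w, dot u w = dot v w) -> u = v.
Proof.
move=> h; apply/eqP; rewrite -subr_eq0 -dot_eq0 dotBl; apply/eqP.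
by rewrite !(dotC _ (u - v)) !(dotC (u - v)) h subrr.
Qed.

Lemma tripleC a b c : triple a b c = triple b c a. Proof. vring. Qed.
Lemma tripleA a b c : triple a b c = - triple b a c. Proof. vring. Qed.
Lemma triple_cross a b c : triple a b c = dot (cross a b) c. Proof. vring. Qed.
Lemma tripleD a b u v : triple a b (u + v) = triple a b u + triple a b v.
Proof. vring. Qed.
Lemma tripleZ a b s u : triple a b (s *: u) = s * triple a b u.
Proof. vring. Qed.
Lemma crossC u v : cross u v = - cross v u. Proof. vecring. Qed.
Lemma cross_cross u v w : cross u (cross v w) = dot u w *: v - dot u v *: w.
Proof. vecring. Qed.
Lemma cross_shear u v w s t : cross (u - s *: w) (v - t *: w) =
  cross u v - t *: cross u w + s *: cross v w.
Proof. vecring. Qed.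
Lemma dot_cross a b c d : dot (cross a b) (cross c d) =
  dot a c * dot b d - dot a d * dot b c.
Proof. vring. Qed.
Lemma cramer a b c x : triple a b c *: x =
  triple b c x *: a + triple c a x *: b + triple a b x *: c.
Proof. vecring. Qed.
Lemma cramer_dual a b c x : triple a b c *: x =
  dot x a *: cross b c + dot x b *: cross c a + dot x c *: cross a b.
Proof. vecring. Qed.

Lemma cross_neq0 a b c : triple a b c != 0 -> cross a b != 0.
Proof. by apply: contraNneq => h; rewrite triple_cross h dot0l. Qed.

Lemma basis_ext a b c u v : triple a b c != 0 ->
  dot u a = dot v a -> dot u b = dot v b -> dot u c = dot v c -> u = v.
Proof.
move=> d0 ha hb hc; apply: (scalerI d0).
by rewrite (cramer_dual a b c u) (cramer_dual a b c v) ha hb hc.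
Qed.

Lemma orthogonal_to_pair a b d : dot d a = 0 -> dot d b = 0 ->
  dot (cross a b) (cross a b) *: d = dot d (cross a b) *: cross a b.
Proof.
move=> ha hb; have: cross (cross a b) (cross d (cross a b)) = 0.
  by rewrite (cross_cross d) ha hb !scale0r subrr; vecring.
by rewrite cross_cross => /eqP; rewrite subr_eq0 => /eqP ->; rewrite dotC.
Qed.

Lemma cross_ortho_eq0 a e : a != 0 -> dot e a = 0 -> cross a e = 0 -> e = 0.
Proof.
move=> a0 ea c0; have : dot (cross a e) (cross a e) = 0 by rewrite c0 dot0l.
rewrite dot_cross ea mulr0 subr0 => /eqP; rewrite mulf_eq0 dot_eq0 (negbTE a0).
by rewrite dot_eq0 => /eqP.
Qed.

Lemma cross_pair_eq0 a b x : cross a b != 0 ->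
  cross x a = 0 -> cross x b = 0 -> x = 0.
Proof.
move=> ab xa xb; have N0 : dot (cross a b) (cross a b) != 0 by rewrite dot_eq0.
apply: (scalerI N0); rewrite scaler0 -triple_cross cramer.
have -> : triple b (cross a b) x = dot (cross x b) (cross a b) by vring.
have -> : triple (cross a b) a x = - dot (cross x a) (cross a b) by vring.
have -> : triple a b x = dot (cross x a) b by vring.
by rewrite xa xb !dot0l oppr0 !scale0r !addr0.
Qed.

End Space.

(** * Simplicial fans *)

(** The hypotheses make [S] the graph of a permutation of the indices it touches, possibly with
    several cycles, so the sum regroups over the pairs of [S]: summation by parts. *)
Lemma abel_cyclic (R : realType) (n : nat) (S : rel 'I_n)
    (G : 'I_n -> 'I_n -> R) (c d : 'I_n -> R) :
  (forall j k l, S j k -> S j l -> k = l) ->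
  (forall j k l, S k j -> S l j -> k = l) ->
  (forall j k, S j k -> exists l, S l j) ->
  (forall j k, S k j -> exists l, S j l) ->
  (forall j k l, S j k -> S l j -> d j = G j k - G l j) ->
  (forall j, (forall k, ~~ S j k) -> d j = 0) ->
  \sum_j c j * d j = \sum_j \sum_(k | S j k) (c j - c k) * G j k.
Proof.
move=> uR uL eL eR dE d0.
have {}dE j : d j = \sum_(k | S j k) G j k - \sum_(k | S k j) G k j.
  have [[k jk]|nex] := pselect (exists k, S j k).
    have [l lj] := eL _ _ jk.
    rewrite (dE _ _ _ jk lj) (big_pred1 k) ?(big_pred1 l) // => m /=.
      by apply/idP/eqP => [mj|->//]; exact: uL mj lj.
    by apply/idP/eqP => [jm|->//]; exact: uR jm jk.
  rewrite d0 => [|k]; last by apply/negP => jk; apply: nex; exists k.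
  rewrite !big_pred0 ?subrr // => k; apply/negbTE/negP => h; apply: nex.
    by have := eR _ _ h.
  by exists k.
transitivity (\sum_j (\sum_(k | S j k) c j * G j k - \sum_(k | S k j) c j * G k j)).
  by apply: eq_bigr => j _; rewrite dE mulrBr !mulr_sumr.
rewrite sumrB [X in _ - X](exchange_big_dep predT) //= -sumrB.
apply: eq_bigr => j _; rewrite -sumrB; apply: eq_bigr => k _; ring.
Qed.

(** * Signs for small positive parameters *)

Section Eventually.
Variable R : realType.

(* [x + s * w] is nonnegative for all small positive [s]. *)
Definition lex (x w : R) := 0 < x \/ x = 0 /\ 0 <= w.

Lemma lex_eventually (x w : R) : exists2 s0, 0 < s0 &
  forall s, 0 < s <= s0 -> 0 <= x + s * w -> lex x w.
Proof.
have [x0|x0|<-] := ltrgtP 0 x; last 2 first.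
(* Up to this bound [s * w] stays below [- x / 2], so [x + s * w] is negative. *)
- exists (- x / (2 * (`|w| + 1))).
    by rewrite divr_gt0 ?mulr_gt0 ?oppr_gt0// ltr_wpDl.
  move=> s /andP[s0]; rewrite ler_pdivlMr ?mulr_gt0 ?ltr_wpDl// => sx h.
  by have := ler_norm w; nra.
- by exists 1 => // s /andP[s0 _] h; right; split=> //; nra.
by exists 1 => // s _ _; left.
Qed.

Lemma fin_eventually (I : finType) (Q : I -> R -> Prop) :
  (forall i, exists2 s0, 0 < s0 & forall s, 0 < s <= s0 -> Q i s) ->
  exists2 s0, 0 < s0 & forall i, Q i s0.
Proof.
move=> h; have /choice[s sP] (i : I) : exists si,
    0 < si /\ forall s', 0 < s' <= si -> Q i s'.
  by have [si ? ?] := h i; exists si.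
have s0 : 0 < \big[Num.min/1]_i s i.
  by apply: lt_bigmin => // i _; case: (sP i).
exists (\big[Num.min/1]_i s i) => // i.
by have [_] := sP i; apply; rewrite s0 bigmin_le_cond.
Qed.

End Eventually.

(** * Complete fans spanned by exposed points *)

Section Fan.
Variables (R : realType) (n : nat).
Local Notation V := 'cV[R]_3.
Variables (p : 'I_n -> V) (T : 'I_n -> 'I_n -> 'I_n -> bool).
Implicit Types (F f g : 'I_n -> R) (e : V) (i j k l a b : 'I_n).

Hypothesis T_cyc : forall i j k, T i j k -> T j k i.
Hypothesis T_pos : forall i j k, T i j k -> 0 < triple (p i) (p j) (p k).
Hypothesis T_cover : forall x : V, exists i j k, [/\ T i j k,
  0 <= triple (p j) (p k) x, 0 <= triple (p k) (p i) x
  & 0 <= triple (p i) (p j) x].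
Hypothesis T_fan : forall i j k i' j' k' (g : 'I_n -> R),
  T i j k -> T i' j' k' -> \sum_a g a *: p a = 0 ->
  (forall a, 0 < g a -> a \in [:: i; j; k]) ->
  (forall a, g a < 0 -> a \in [:: i'; j'; k']) -> forall a, g a = 0.
Hypothesis T_face : forall i j k, T i j k -> exists w : V,
  [/\ dot w (p i) = 1, dot w (p j) = 1, dot w (p k) = 1
    & forall b, dot w (p b) <= 1].
Hypothesis p_exposed : forall i, exists w : V,
  dot w (p i) = 1 /\ forall j, j != i -> dot w (p j) < 1.

Let T_neq i j k : T i j k -> [/\ i != j, j != k & k != i].
Proof.
move=> /T_pos h; split; apply: contraTneq h => ->; rewrite -leNgt;
  by rewrite le_eqVlt; apply/orP; left; apply/eqP; vring.
Qed.

Let T_cycr i j k : T i j k = T j k i.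
Proof. by apply/idP/idP => [/T_cyc//|/T_cyc/T_cyc]. Qed.

(** Each sign condition has its own threshold, and the finitely many pairs share a smaller one,
    [s0]. A cone that contains the single point [x + s0 *: w] therefore contains [x + s *: w] for
    all small positive [s]. *)
Let star_cover (x w : V) : exists i j k, [/\ T i j k,
  lex (triple (p j) (p k) x) (triple (p j) (p k) w),
  lex (triple (p k) (p i) x) (triple (p k) (p i) w)
  & lex (triple (p i) (p j) x) (triple (p i) (p j) w)].
Proof.
pose Q (t : 'I_n * 'I_n) s :=
  0 <= triple (p t.1) (p t.2) x + s * triple (p t.1) (p t.2) w ->
  lex (triple (p t.1) (p t.2) x) (triple (p t.1) (p t.2) w).
have [s0 s00 sQ] : exists2 s0, 0 < s0 & forall t, Q t s0.
  by apply: fin_eventually => t; exact: lex_eventually.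
have [i [j [k [ijk]]]] := T_cover (x + s0 *: w).
rewrite !tripleD !tripleZ => /(sQ (j, k)) h1 /(sQ (k, i)) h2 /(sQ (i, j)) h3.
by exists i, j, k.
Qed.

Let lex_ge0 (x w : R) : lex x w -> 0 <= x.
Proof. by case=> [/ltW//|[->]]. Qed.

Let lex0 (x w : R) : lex x w -> x = 0 -> 0 <= w.
Proof. by case=> [h x0|[_]//]; move: h; rewrite x0 ltxx. Qed.

(** Uniqueness of cone coefficients, in a form that leaves the signs at common vertices of the two
    triangles free. *)
Let fan_inj i j k i' j' k' F G :
  T i j k -> T i' j' k' -> \sum_a F a *: p a = \sum_a G a *: p a ->
  (forall a, G a < F a -> a \in [:: i; j; k]) ->
  (forall a, F a < G a -> a \in [:: i'; j'; k']) -> F =1 G.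
Proof.
move=> ijk ijk' e h1 h2 a; apply/eqP; rewrite -subr_eq0; apply/eqP.
apply: (T_fan (g := fun a => F a - G a) ijk ijk') => [|b|b].
- under eq_bigr do rewrite scalerBl.
  by rewrite sumrB e subrr.
- by rewrite subr_gt0; exact: h1.
- by rewrite subr_lt0; exact: h2.
Qed.

(** Coefficients are extended by zero to all indices, so that expansions in different triangles can
    be compared by [fan_inj]. *)
Definition comb3 i j k (x y z : R) a : R :=
  x * (a == i)%:R + y * (a == j)%:R + z * (a == k)%:R.

Lemma sum_comb3 i j k x y z (W : lmodType R) (v : 'I_n -> W) :
  \sum_a comb3 i j k x y z a *: v a = x *: v i + y *: v j + z *: v k.
Proof.
have E l (s : R) : \sum_a (s * (a == l)%:R) *: v a = s *: v l.
  rewrite (bigD1 l) //= eqxx mulr1 big1 ?addr0 // => a /negbTE ->.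
  by rewrite mulr0 scale0r.
by under eq_bigr do rewrite !scalerDl; rewrite !big_split /= !E.
Qed.

Lemma sum_comb3r i j k x y z F :
  \sum_a comb3 i j k x y z a * F a = x * F i + y * F j + z * F k.
Proof. exact: (@sum_comb3 i j k x y z R^o). Qed.

(** The supporting plane of the triangle bounds the sum of the coordinates of [p l] by the
    determinant, while a functional exposing a further [p l] is 1 there and below 1 at the three
    vertices. Together they force all coordinates to be zero. *)
Let cone_mem i j k l : T i j k ->
  0 <= triple (p j) (p k) (p l) -> 0 <= triple (p k) (p i) (p l) ->
  0 <= triple (p i) (p j) (p l) -> l \in [:: i; j; k].
Proof.
move=> ijk; have d0 := T_pos ijk; have := cramer (p i) (p j) (p k) (p l).
move=> e x0 y0 z0.
apply/negPn/negP; rewrite !inE !negb_or => /and3P[li lj lk].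
have [w [wl wlt]] := p_exposed l; have [v [vi vj vk vle]] := T_face ijk.
move: (wlt i) (wlt j) (wlt k); rewrite !(eq_sym _ l).
move=> /(_ li) wi /(_ lj) wj /(_ lk) wk.
move: (vle l); have := congr1 (dot v) e; have := congr1 (dot w) e.
rewrite !dotDr !dotZr wl vi vj vk => ew ev vl.
have dv : triple (p i) (p j) (p k) * dot v (p l) <= triple (p i) (p j) (p k).
  by rewrite ler_piMr // ltW.
have nul (x s : R) : s < 1 -> x * (1 - s) = 0 -> x = 0.
  by move=> s1 /eqP; rewrite mulf_eq0 subr_eq0 (gt_eqF s1) orbF => /eqP.
have nonneg (x s : R) : 0 <= x -> s < 1 -> 0 <= x * (1 - s).
  by move=> ? /ltW s1; rewrite mulr_ge0 // subr_ge0.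
have hx := nonneg _ _ x0 wi; have hy := nonneg _ _ y0 wj; have hz := nonneg _ _ z0 wk.
have ex := nul _ _ wi (ltac:(lra) : triple (p j) (p k) (p l) * (1 - dot w (p i)) = 0).
have ey := nul _ _ wj (ltac:(lra) : triple (p k) (p i) (p l) * (1 - dot w (p j)) = 0).
have ez := nul _ _ wk (ltac:(lra) : triple (p i) (p j) (p l) * (1 - dot w (p k)) = 0).
by move: ew d0; rewrite ex ey ez; lra.
Qed.

Let comb3_ge0 i j k x y z a : 0 <= x -> 0 <= y -> 0 <= z ->
  0 <= comb3 i j k x y z a.
Proof. by move=> *; rewrite /comb3 !addr_ge0 ?mulr_ge0. Qed.

Let comb3_out i j k x y z a : a \notin [:: i; j; k] -> comb3 i j k x y z a = 0.
Proof.
rewrite !inE !negb_or => /and3P[/negbTE ai /negbTE aj /negbTE ak].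
by rewrite /comb3 ai aj ak !mulr0 !addr0.
Qed.

(** A cone containing [p i + s *: e] for all small [s] contains [p i], and by [cone_mem] it has [i]
    as a vertex. *)
Let vertex_star i e : exists j k,
  [/\ T i j k, 0 <= triple (p k) (p i) e & 0 <= triple (p i) (p j) e].
Proof.
have [a [b [c [abc h1 h2 h3]]]] := star_cover (p i) e.
have z1 x : triple x (p i) (p i) = 0 by vring.
have z2 x : triple (p i) x (p i) = 0 by vring.
have := cone_mem abc (lex_ge0 h1) (lex_ge0 h2) (lex_ge0 h3).
rewrite !inE => /or3P[]/eqP ia; subst i.
- by exists b, c; split=> //; [apply: lex0 h2 _|apply: lex0 h3 _].
- exists c, a; split; [by rewrite -T_cycr| |].
    by apply: lex0 h3 _.
  by apply: lex0 h1 _.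
- exists a, b; split; [by rewrite T_cycr| |].
    by apply: lex0 h1 _.
  by apply: lex0 h2 _.
Qed.

Let edge_cone i j k a b c : T i j k -> T a b c ->
  0 <= triple (p b) (p c) (p i + p j) -> 0 <= triple (p c) (p a) (p i + p j) ->
  0 <= triple (p a) (p b) (p i + p j) -> i \in [:: a; b; c] /\ j \in [:: a; b; c].
Proof.
move=> ijk abc x0 y0 z0; have d0 := T_pos abc; have [nij njk nki] := T_neq ijk.
have e := cramer (p a) (p b) (p c) (p i + p j).
set d := triple (p a) _ _ in d0 e.
have E : comb3 i j k d d 0 =1 comb3 a b c (triple (p b) (p c) (p i + p j))
    (triple (p c) (p a) (p i + p j)) (triple (p a) (p b) (p i + p j)).
  apply: (fan_inj ijk abc) => [|l|l].
  - by rewrite !sum_comb3 -e scale0r addr0 scalerDr.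
  - by apply: contraLR => /comb3_out ->; rewrite -leNgt comb3_ge0.
  - by apply: contraLR => /comb3_out ->; rewrite -leNgt comb3_ge0// ltW.
split; apply/negPn/negP => /comb3_out h; [have := E i|have := E j];
  rewrite h /comb3 eqxx.
- by rewrite (negbTE nij) (eq_sym i k) (negbTE nki) /=; lra.
- by rewrite (eq_sym j i) (negbTE nij) (negbTE njk) /=; lra.
Qed.

(** A point over the edge is pushed across the plane through the origin, [p i] and [p j]. The
    triangle found there has both end points as vertices, and the orientation [i j] would place it
    on the wrong side. *)
Let edge_opposite i j k : T i j k -> exists l, T j i l.
Proof.
move=> ijk; have d0 := T_pos ijk.
have [a [b [c [abc h1 h2 h3]]]] := star_cover (p i + p j) (- cross (p i) (p j)).
have [] := edge_cone ijk abc (lex_ge0 h1) (lex_ge0 h2) (lex_ge0 h3).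
have N0 : 0 < dot (cross (p i) (p j)) (cross (p i) (p j)).
  by rewrite dot_gt0 // (cross_neq0 (c := p k)) // gt_eqF.
have no : lex (triple (p i) (p j) (p i + p j))
    (triple (p i) (p j) (- cross (p i) (p j))) -> False.
  move=> /lex0; rewrite [X in X = 0]triple_cross triple_cross dotNr => h.
  suff /h : dot (cross (p i) (p j)) (p i + p j) = 0 by lra.
  by vring.
have [nij _ _] := T_neq ijk.
rewrite !inE => /or3P[]/eqP ia /or3P[]/eqP ja; subst i j; rewrite ?eqxx in nij => //;
  first [ by case: (no h1) | by case: (no h2) | by case: (no h3)
        | by exists a; rewrite -T_cycr | by exists b; rewrite T_cycr | by exists c ].
Qed.

(** Both [p k] and [p l] lie on the same side of the plane spanned by the edge, so [p l] has a
    positive coefficient at [p k] in the basis [i j k]. The other two coefficients may be negative,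
    but [i] and [j] are common vertices. *)
Let edge_unique i j k l : T i j k -> T i j l -> k = l.
Proof.
move=> ijk ijl; have d0 := T_pos ijk; have z0 := T_pos ijl.
have [_ njl nli] := T_neq ijl.
have e := cramer (p i) (p j) (p k) (p l).
set d := triple (p i) _ _ in d0 e; set z := triple (p i) _ _ in z0 e.
have E : comb3 i j l 0 0 d =1
    comb3 i j k (triple (p j) (p k) (p l)) (triple (p k) (p i) (p l)) z.
  apply: (fan_inj ijl ijk) => [|a|a].
  - by rewrite !sum_comb3 -e !scale0r !add0r.
  - apply: contraLR => al; rewrite (comb3_out _ _ _ al) -leNgt.
    move: al; rewrite !inE !negb_or => /and3P[/negbTE ai /negbTE aj _].
    by rewrite /comb3 ai aj !mulr0 !add0r mulr_ge0 // ltW.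
  - by apply: contraLR => /comb3_out ->; rewrite -leNgt comb3_ge0// ltW.
apply/eqP/negPn/negP => kl; have := E l.
rewrite /comb3 eqxx (negbTE nli) (eq_sym l j) (negbTE njl) (eq_sym l k).
rewrite (negbTE kl) /=; lra.
Qed.

(** * Piecewise linear functions and their jumps across edges *)

Definition grad F i j k : V := (triple (p i) (p j) (p k))^-1 *:
  (F i *: cross (p j) (p k) + F j *: cross (p k) (p i) + F k *: cross (p i) (p j)).

Let grad_cyc F i j k : grad F i j k = grad F j k i.
Proof. by rewrite /grad tripleC -addrA addrC -addrA; congr (_ *: _); rewrite addrA. Qed.

Let gradE F i j k e : T i j k ->
  triple (p i) (p j) (p k) * dot (grad F i j k) e =
  F i * triple (p j) (p k) e + F j * triple (p k) (p i) e + F k * triple (p i) (p j) e.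
Proof.
move=> /T_pos /gt_eqF/negbT d0.
rewrite dotZl mulrA divff // mul1r !dotDl !dotZl.
by rewrite !triple_cross.
Qed.

Let grad_dot F i j k : T i j k ->
  [/\ dot (grad F i j k) (p i) = F i, dot (grad F i j k) (p j) = F j
    & dot (grad F i j k) (p k) = F k].
Proof.
suff h a b c : T a b c -> dot (grad F a b c) (p a) = F a.
  move=> ijk; rewrite h //; split=> //.
    by rewrite grad_cyc h // -T_cycr.
  by rewrite -grad_cyc h // T_cycr.
move=> abc; have d0 := T_pos abc; apply: (mulfI (lt0r_neq0 d0)).
rewrite gradE // -(tripleC (p a)).
have -> : triple (p c) (p a) (p a) = 0 by vring.
have -> : triple (p a) (p b) (p a) = 0 by vring.
by ring.
Qed.

(* The rotation vectors of adjacent triangles differ by a multiple of the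
   edge vector, their translation vectors (the gradients) by the same multiple
   [lam] of the cross product of the end points. *)
Definition lam F i j : R :=
  dot (\sum_(k | T i j k) grad F i j k - \sum_(k | T j i k) grad F j i k)
    (cross (p i) (p j)) / dot (cross (p i) (p j)) (cross (p i) (p j)).

Let lam_sym F i j : lam F i j = lam F j i.
Proof.
by rewrite /lam (crossC (p j)) !(dotNl, dotNr) opprK -opprB dotNl.
Qed.

Let lam0 F i j : (forall k, ~~ T i j k) -> lam F i j = 0.
Proof.
move=> h; rewrite /lam !big_pred0 ?subrr ?dot0l ?mul0r // => k; apply/negbTE/negP.
  by move=> /edge_opposite[l]; apply/negP.
by apply/negP.
Qed.

Let lamE F i j k l : T i j k -> T j i l ->
  lam F i j = dot (grad F i j k - grad F j i l) (cross (p i) (p j)) /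
    dot (cross (p i) (p j)) (cross (p i) (p j)).
Proof.
move=> ijk jil; rewrite /lam (big_pred1 k) ?(big_pred1 l) // => m /=.
  by apply/idP/eqP => [h|->//]; exact: edge_unique h jil.
by apply/idP/eqP => [h|->//]; exact: edge_unique h ijk.
Qed.

Let lamP F i j k l : T i j k -> T j i l ->
  grad F i j k - grad F j i l = lam F i j *: cross (p i) (p j).
Proof.
move=> ijk jil; rewrite (lamE _ ijk jil).
have N0 : dot (cross (p i) (p j)) (cross (p i) (p j)) != 0.
  by rewrite dot_eq0 (cross_neq0 (c := p k)) // gt_eqF // T_pos.
apply: (scalerI N0); rewrite scalerA mulrCA divff // mulr1.
have [h1 h2 _] := grad_dot F ijk; have [h3 h4 _] := grad_dot F jil.
by apply: orthogonal_to_pair; rewrite dotBl ?h1 ?h2 ?h3 ?h4 subrr.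
Qed.

Let grad_lin F G c w i j k : T i j k ->
  grad (fun a => F a - c * G a - dot w (p a)) i j k =
  grad F i j k - c *: grad G i j k - w.
Proof.
move=> ijk; have [f1 f2 f3] := grad_dot F ijk; have [g1 g2 g3] := grad_dot G ijk.
have [h1 h2 h3] := grad_dot (fun a => F a - c * G a - dot w (p a)) ijk.
apply: (basis_ext (lt0r_neq0 (T_pos ijk))).
- by rewrite h1 !dotBl (dotZl c) f1 g1.
- by rewrite h2 !dotBl (dotZl c) f2 g2.
- by rewrite h3 !dotBl (dotZl c) f3 g3.
Qed.

Let lam_lin F G c w i j :
  lam (fun a => F a - c * G a - dot w (p a)) i j = lam F i j - c * lam G i j.
Proof.
have [[k ijk]|nex] := pselect (exists k, T i j k); last first.
  have nT k : ~~ T i j k by apply/negP => ?; apply: nex; exists k.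
  by rewrite !lam0 //; ring.
have [l jil] := edge_opposite ijk.
rewrite !(lamE _ ijk jil) mulrA -mulrBl; congr (_ / _).
rewrite -dotZl -dotBl !grad_lin //; congr (dot _ _).
by rewrite scalerBr; apply/colP => m; rewrite !mxE; ring.
Qed.

(* A triangle [i j k] with these two nonnegative coordinates contains the
   points [p i + s *: e] for all small positive [s], up to scaling. *)
Let grad_dir F e i j k j' k' : T i j k -> T i j' k' ->
  0 <= triple (p k) (p i) e -> 0 <= triple (p i) (p j) e ->
  0 <= triple (p k') (p i) e -> 0 <= triple (p i) (p j') e ->
  dot (grad F i j k) e = dot (grad F i j' k') e.
Proof.
move=> ijk ijk' y0 z0 y0' z0'; have d0 := T_pos ijk; have d0' := T_pos ijk'.
have c := cramer (p i) (p j) (p k) e; have c' := cramer (p i) (p j') (p k') e.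
have g := gradE F e ijk; have g' := gradE F e ijk'.
set d := triple (p i) (p j) (p k) in d0 c g *.
set d' := triple (p i) (p j') (p k') in d0' c' g' *.
set x := triple (p j) _ _ in c g; set x' := triple (p j') _ _ in c' g'.
set y := triple (p k) _ _ in y0 c g; set y' := triple (p k') _ _ in y0' c' g'.
set z := triple (p i) (p j) _ in z0 c g; set z' := triple (p i) (p j') _ in z0' c' g'.
(* The factors [d'] and [d] clear denominators. The coefficients at [p i] may have any sign, as [i]
   belongs to both triangles. *)
have E : comb3 i j k (d' * x) (d' * y) (d' * z) =1
         comb3 i j' k' (d * x') (d * y') (d * z').
  apply: (fan_inj ijk ijk') => [|a|a].
  - by rewrite !sum_comb3 -!scalerA -!scalerDr -c -c' !scalerA mulrC.
  - apply: contraLR => al; rewrite (comb3_out _ _ _ al) -leNgt.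
    move: al; rewrite !inE !negb_or => /and3P[/negbTE ai _ _].
    by rewrite /comb3 ai mulr0 add0r addr_ge0 // !mulr_ge0 // ltW.
  - apply: contraLR => al; rewrite (comb3_out _ _ _ al) -leNgt.
    move: al; rewrite !inE !negb_or => /and3P[/negbTE ai _ _].
    by rewrite /comb3 ai mulr0 add0r addr_ge0 // !mulr_ge0 // ltW.
have : \sum_a comb3 i j k (d' * x) (d' * y) (d' * z) a * F a =
    \sum_a comb3 i j' k' (d * x') (d * y') (d * z') a * F a.
  by apply: eq_bigr => a _; rewrite E.
rewrite !sum_comb3r => s.
apply: (mulfI (lt0r_neq0 d0)); apply: (mulfI (lt0r_neq0 d0')).
by rewrite g mulrCA g'; transitivity (d' * x * F i + d' * y * F j + d' * z * F k);
  [ring|rewrite s; ring].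
Qed.

(** * The quadratic form at a vertex *)

Section Vertex.
Variable i : 'I_n.

Lemma vertex_abel (G : 'I_n -> 'I_n -> R) (c d : 'I_n -> R) :
  (forall j k l, T i j k -> T j i l -> d j = G j k - G l j) ->
  (forall j, (forall k, ~~ T i j k) -> d j = 0) ->
  \sum_j c j * d j = \sum_j \sum_(k | T i j k) (c j - c k) * G j k.
Proof.
move=> h1 h2; apply: (abel_cyclic (S := T i)) => //.
- by move=> j k l; exact: edge_unique.
- move=> j k l; rewrite (T_cycr i k) (T_cycr k) (T_cycr i l) (T_cycr l).
  exact: edge_unique.
- by move=> j k /edge_opposite[l jil]; exists l; rewrite -T_cycr.
- move=> j k; rewrite (T_cycr i k) (T_cycr k) => /edge_opposite[l ?].
  by exists l.
- by move=> j k l ijk ilj; apply: h1 => //; rewrite -T_cycr -T_cycr.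
Qed.

Local Notation h e j := (triple (p i) (p j) e).
Local Notation t F e j k := (dot (grad F i j k) e).

(** The right-hand side is a discrete Wronskian of [h] and [F]; through it [t] becomes a difference
    of quotients [F / h] or [h / F]. *)
Let tE F e j k : T i j k -> F i = 0 ->
  triple (p i) (p j) (p k) * t F e j k = h e j * F k - h e k * F j.
Proof.
by move=> ijk Fi; rewrite gradE // Fi (tripleA (p k)); ring.
Qed.

Let lam_h F e j k l : T i j k -> T j i l ->
  lam F i j * h e j = t F e j k - t F e l j.
Proof.
move=> ijk jil; rewrite triple_cross -dotZl -(lamP F ijk jil) dotBl.
by rewrite (grad_cyc F j).
Qed.

Let next j k : T i j k -> exists l, T i k l.
Proof. by rewrite !(T_cycr i) !(T_cycr _ _ i) => /edge_opposite. Qed.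

(** The case at stake is [h e j = 0], where the quotient is 0 by convention and [chi j] must vanish.
    The Wronskian leaves [h e k * chi j = 0], and [h e k = 0] would make [e] parallel to [p i]. *)
Let chi_factor chi e j k : chi i = 0 -> cross (p i) e != 0 ->
  (forall j k, T i j k -> h e j * h e k <= 0 -> t chi e j k = 0) ->
  T i j k -> chi j = chi j / h e j * h e j.
Proof.
move=> chi0 e0 ht ijk; have [hj|hj] := eqVneq (h e j) 0; last by rewrite divfK.
have := tE e ijk chi0; rewrite ht ?hj ?mul0r ?mulr0 // sub0r.
move=> /esym/eqP; rewrite oppr_eq0 mulf_eq0 => /orP[/eqP hk|/eqP //].
have /eqP := congr1 (cross (p i)) (cramer (p i) (p j) (p k) e).
have -> : triple (p k) (p i) e = 0 by rewrite tripleA -/(h e k) hk oppr0.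
rewrite -/(h e j) hj !scale0r !addr0.
have -> x y : cross (p i) (x *: y) = x *: cross (p i) y by vecring.
have -> x : cross (p i) (x *: p i) = 0 by vecring.
by rewrite scaler_eq0 (negbTE e0) (gt_eqF (T_pos ijk)).
Qed.

(* Jacobi's transformation: writing [chi = g * h], where [h] vanishes along [e],
   turns the sum into minus a sum of squares [h_j h_k (g_j - g_k)^2]. *)
Let jacobi_le0 chi e : chi i = 0 -> cross (p i) e != 0 ->
  (forall j k, T i j k -> h e j * h e k <= 0 -> t chi e j k = 0) ->
  \sum_j lam chi i j * chi j <= 0 /\
  (\sum_j lam chi i j * chi j = 0 -> forall j k, T i j k -> t chi e j k = 0).
Proof.
move=> chi0 e0 ht; pose g j := chi j / h e j.
have -> : \sum_j lam chi i j * chi j =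
    - \sum_j \sum_(k | T i j k) (g k - g j) * t chi e j k.
  transitivity (\sum_j g j * (lam chi i j * h e j)).
    apply: eq_bigr => j _; have [[k ijk]|nex] := pselect (exists k, T i j k).
      by rewrite (chi_factor chi0 e0 ht ijk) -/(g j); ring.
    by rewrite lam0 ?mul0r ?mulr0 // => k; apply/negP => ?; apply: nex; exists k.
  rewrite (vertex_abel (G := fun j k => t chi e j k)).
  - rewrite -sumrN; apply: eq_bigr => j _; rewrite -sumrN; apply: eq_bigr => k _.
    by ring.
  - by move=> j k l; exact: lam_h.
  - by move=> j nj; rewrite lam0 ?mul0r.
have term j k : T i j k ->
    0 <= (g k - g j) * t chi e j k /\
    ((g k - g j) * t chi e j k = 0 -> t chi e j k = 0).
  move=> ijk; have [hjk|hjk] := leP (h e j * h e k) 0.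
    by rewrite ht // mulr0.
  have d0 := T_pos ijk; have := tE e ijk chi0.
  have [l ikl] := next ijk.
  rewrite (chi_factor chi0 e0 ht ijk) (chi_factor chi0 e0 ht ikl).
  rewrite -/(g j) -/(g k).
  set d := triple _ _ _ in d0 *; set tt := dot (grad _ _ _ _) _.
  move=> dt; have {}dt : d * tt = (h e j * h e k) * (g k - g j) by rewrite dt; ring.
  have -> : tt = (h e j * h e k) / d * (g k - g j).
    by apply: (mulfI (lt0r_neq0 d0)); rewrite dt mulrA mulrCA divff ?lt0r_neq0 // mulr1.
  have c0 : 0 < h e j * h e k / d by rewrite divr_gt0.
  split; first by rewrite mulrCA mulr_ge0 ?(ltW c0) // -expr2 sqr_ge0.
  by move=> /eqP; rewrite mulf_eq0 => /orP[/eqP ->|/eqP //]; rewrite mulr0.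
have inner j : 0 <= \sum_(k | T i j k) (g k - g j) * t chi e j k.
  by apply: sumr_ge0 => k /term[].
split; first by rewrite oppr_le0 sumr_ge0.
move=> /eqP; rewrite oppr_eq0 => /eqP z j k ijk.
have zj : \sum_(b | T i j b) _ = 0 :=
  psumr_eq0P (fun j (_ : xpredT j) => inner j) z isT.
have [_] := term _ _ ijk; apply.
by apply: (psumr_eq0P _ zj) => // l /term[].
Qed.

(* The same transformation with the roles exchanged, [h = g * psi]. *)
Let lam_psi_gt0 psi e : psi i = 0 -> (forall j, j != i -> 0 < psi j) ->
  (exists j k, T i j k /\ t psi e j k != 0) -> exists j, lam psi i j != 0.
Proof.
move=> psi0 psi_gt0 [j [k [ijk tjk]]]; apply: contrapT => none.
have lam_eq0 l : lam psi i l = 0.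
  by apply/eqP; apply: contrapT => /negP ?; apply: none; exists l.
pose g j := h e j / psi j.
have gt0 a b : T i a b -> 0 < psi a /\ 0 < psi b.
  by move=> /T_neq[ia _ bi]; split; apply: psi_gt0; rewrite // eq_sym.
have term a b : T i a b -> 
    (g a - g b) * t psi e a b =
    triple (p i) (p a) (p b) / (psi a * psi b) * t psi e a b ^+ 2.
  move=> iab; have [a0 b0] := gt0 _ _ iab; have d0 := T_pos iab.
  have -> : g a - g b = triple (p i) (p a) (p b) * t psi e a b / (psi a * psi b).
    rewrite (tE e iab psi0) /g; field; by rewrite !lt0r_neq0.
  by ring.
have term_ge0 a b : T i a b -> 0 <= (g a - g b) * t psi e a b.
  move=> iab; have [a0 b0] := gt0 _ _ iab.
  by rewrite term // mulr_ge0 ?sqr_ge0 // divr_ge0 ?mulr_ge0 // ltW // T_pos.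
have z : \sum_a \sum_(b | T i a b) (g a - g b) * t psi e a b = 0.
  rewrite -(@vertex_abel (fun j k => t psi e j k) g (fun j => lam psi i j * h e j)).
  - by rewrite big1 // => a _; rewrite lam_eq0 mul0r mulr0.
  - by move=> a b l; exact: lam_h.
  - by move=> a na; rewrite lam0 ?mul0r.
have inner a : 0 <= \sum_(b | T i a b) (g a - g b) * t psi e a b.
  by apply: sumr_ge0 => b; exact: term_ge0.
have zj : \sum_(b | T i j b) _ = 0 :=
  psumr_eq0P (fun j (_ : xpredT j) => inner j) z isT.
have := psumr_eq0P (term_ge0 j) zj ijk.
have [a0 b0] := gt0 _ _ ijk.
rewrite term // => /eqP; rewrite !mulf_eq0 (negbTE tjk) !orbF.
by rewrite invr_eq0 mulf_eq0 !gt_eqF // T_pos.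
Qed.

(* [p_i . (grad F x grad G)] jumps by [|p_i|^2 (lam G F_j - lam F G_j)]. *)
Let lam_symmetric F G : F i = 0 -> G i = 0 ->
  \sum_j lam F i j * G j = \sum_j lam G i j * F j.
Proof.
move=> Fi Gi; apply/eqP; rewrite -subr_eq0 -sumrB; apply/eqP.
pose w j k := dot (p i) (cross (grad F i j k) (grad G i j k)).
have [/eqP pi0|pi0] := boolP (p i == 0).
  by have [w0 []] := p_exposed i; rewrite pi0 dot0r => /eqP; rewrite eq_sym oner_eq0.
apply: (mulfI (_ : dot (p i) (p i) != 0)); first by rewrite dot_eq0.
rewrite mulr0 mulr_sumr.
transitivity (\sum_j (1 : R) * (dot (p i) (p i) * (lam F i j * G j - lam G i j * F j))).
  by apply: eq_bigr => j _; rewrite mul1r.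
rewrite (vertex_abel (G := fun j k => - w j k)).
- by rewrite big1 // => j _; rewrite big1 // => k _; rewrite subrr mul0r.
- move=> j k l ijk jil.
  have [f1 f2 f3] := grad_dot F ijk; have [g1 g2 g3] := grad_dot G ijk.
  have eF := lamP F ijk jil; have eG := lamP G ijk jil.
  have {}eF : grad F i l j = grad F i j k - lam F i j *: cross (p i) (p j).
    by rewrite -eF (grad_cyc F j) opprB addrC subrK.
  have {}eG : grad G i l j = grad G i j k - lam G i j *: cross (p i) (p j).
    by rewrite -eG (grad_cyc G j) opprB addrC subrK.
  rewrite /w eF eG -f2 -g2; move: f1 g1; rewrite Fi Gi.
  set u := grad F i j k; set v := grad G i j k; move: (lam F i j) (lam G i j) => a b.
  rewrite cross_shear !cross_cross dotDr dotBr !dotZr !dotBr !dotZr.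
  by move=> -> ->; ring.
- by move=> j nj; rewrite !lam0 //; ring.
Qed.

(** A linear term creates no jump, and the extension of the constant 1 is the gauge of the surface.
    Its convexity is [T_face]: [p k] lies below the plane of the triangle across the edge. *)
Let lam_psi_ge0 w j : lam (fun a => 1 - dot w (p a)) i j >= 0.
Proof.
have [[k ijk]|nex] := pselect (exists k, T i j k); last first.
  by rewrite lam0 // => k; apply/negP => ?; apply: nex; exists k.
have [l jil] := edge_opposite ijk; have d0 := T_pos ijk.
pose psi a := 1 - dot w (p a).
have [_ _ gk] := grad_dot psi ijk; have [gj gi gl] := grad_dot psi jil.
have [v [vj vi vl vle]] := T_face jil.
have gv : grad psi j i l = v - w.
  apply: (basis_ext (lt0r_neq0 (T_pos jil))).
  - by rewrite gj dotBl vj.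
  - by rewrite gi dotBl vi.
  - by rewrite gl dotBl vl.
have := congr1 (fun x => dot x (p k)) (lamP psi ijk jil).
rewrite /= dotBl dotZl -triple_cross gk gv dotBl /psi => E.
by rewrite -(pmulr_lge0 _ d0) -E; have := vle k; lra.
Qed.

(** As [e] is not parallel to [p i], it has a positive coordinate at [p j] or at [p k], where [psi]
    is positive. *)
Lemma grad_psi_gt0 psi e j k : psi i = 0 -> (forall j, j != i -> 0 < psi j) ->
  cross (p i) e != 0 -> T i j k ->
  0 <= triple (p k) (p i) e -> 0 <= triple (p i) (p j) e ->
  0 < dot (grad psi i j k) e.
Proof.
move=> psi0 psi_gt0 e0 ijk y0 z0; have d0 := T_pos ijk.
have [ij _ ki] := T_neq ijk; have pj := psi_gt0 j; have pk := psi_gt0 _ ki.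
rewrite eq_sym in pj; have {}pj := pj ij.
rewrite -(pmulr_rgt0 _ d0) gradE // psi0 mul0r add0r.
have yj := mulr_ge0 (ltW pj) y0; have zk := mulr_ge0 (ltW pk) z0.
rewrite lt_def addr_ge0 // andbT paddr_eq0 // !mulf_eq0.
rewrite (gt_eqF pj) (gt_eqF pk) /=.
apply: contraNN e0 => /andP[/eqP y1 /eqP z1].
have := congr1 (cross (p i)) (cramer (p i) (p j) (p k) e).
rewrite y1 z1 !scale0r !addr0.
have -> x y : cross (p i) (x *: y) = x *: cross (p i) y by vecring.
have -> x : cross (p i) (x *: p i) = 0 by vecring.
by move=> /eqP; rewrite scaler_eq0 (gt_eqF d0).
Qed.

(* [chi] is [f] corrected by a multiple of [psi] and a linear functional so that
   its piecewise linear extension vanishes in both directions [e] and [- e]. *)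
Lemma vertex_form f e : cross (p i) e != 0 ->
  (forall w, \sum_j lam f i j * dot w (p j - p i) = 0) ->
  \sum_j lam f i j * (f j - f i) <= 0 /\
  (\sum_j lam f i j * (f j - f i) = 0 ->
   forall j k j' k', T i j k -> T i j' k' -> t f e j k = t f e j' k').
Proof.
move=> e0 stress.
have [u [ui ult]] := p_exposed i; pose psi a := 1 - dot u (p a).
have psi0 : psi i = 0 by rewrite /psi ui subrr.
have psi_gt0 j : j != i -> 0 < psi j by move=> /ult; rewrite subr_gt0.
have [j1 [k1 [T1 y1 z1]]] := vertex_star i e.
have [j2 [k2 [T2 y2 z2]]] := vertex_star i (- e).
have e0' : cross (p i) (- e) != 0.
  by have -> : cross (p i) (- e) = - cross (p i) e; [vecring|rewrite oppr_eq0].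
have g1 := grad_psi_gt0 psi0 psi_gt0 e0 T1 y1 z1.
have := grad_psi_gt0 psi0 psi_gt0 e0' T2 y2 z2; rewrite dotNr => g2.
(* [D F] is the sum of the one-sided derivatives of [F] at [p i] along [e] and [- e]. For [psi] both
   are positive. *)
pose D F := t F e j1 k1 - t F e j2 k2.
have D0 : D psi != 0 by apply: lt0r_neq0; rewrite /D; lra.
(* This [c] makes the two one-sided derivatives of [f - c psi] opposite; subtracting its gradient
   [l] on the first triangle then makes both vanish. *)
pose c := D f / D psi.
have cD : c * D psi = D f by rewrite /c divfK.
pose l := grad f i j1 k1 - c *: grad psi i j1 k1.
pose chi a := f a - c * psi a - dot l (p a).
have [f1 _ _] := grad_dot f T1; have [p1 _ _] := grad_dot psi T1.
have li : dot l (p i) = f i by rewrite /l dotBl (dotZl c) f1 p1 psi0 mulr0 subr0.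
have chi0 : chi i = 0 by rewrite /chi psi0 li; ring.
have tchi j k : T i j k ->
    t chi e j k = (t f e j k - t f e j1 k1) - c * (t psi e j k - t psi e j1 k1).
  by move=> ijk; rewrite grad_lin // !dotBl !(dotZl c); ring.
have crossing j k : T i j k -> h e j * h e k <= 0 -> t chi e j k = 0.
  move=> ijk hjk; rewrite tchi //.
  have hN v : triple (p v) (p i) e = - h e v by exact: tripleA.
  have hNN v : triple (p v) (p i) (- e) = h e v by vring.
  have hN' v : triple (p i) (p v) (- e) = - h e v by vring.
  (* The triangle contains the direction [e] in the first case and [- e] in the second, so
     [grad_dir] compares it with the triangle chosen for that direction. *)
  have [hj|hj] : h e j >= 0 /\ h e k <= 0 \/ h e j <= 0 /\ h e k >= 0.
    by have [?|?] := lerP 0 (h e j); have [?|?] := lerP 0 (h e k); (try nra); lra.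
  - have [hj0 hk0] := hj.
    have E F : t F e j k = t F e j1 k1.
      by apply: grad_dir => //; rewrite hN oppr_ge0.
    by rewrite !E !subrr mulr0 subrr.
  - have [hj0 hk0] := hj.
    have E F : t F e j k = t F e j2 k2.
      apply: oppr_inj; rewrite -!dotNr; apply: grad_dir => //.
        by rewrite hNN.
      by rewrite hN' oppr_ge0.
    rewrite !E; have := cD; rewrite /D; lra.
have [J1 J2] := jacobi_le0 chi0 e0 crossing.
have psi_stress : \sum_j lam f i j * psi j = 0.
  transitivity (- \sum_j lam f i j * dot u (p j - p i)).
    by rewrite -sumrN; apply: eq_bigr => j _; rewrite /psi dotBr ui; ring.
  by rewrite stress oppr0.
have lamchi j : lam chi i j = lam f i j - c * lam psi i j by exact: lam_lin.
pose J := \sum_j lam psi i j * psi j.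
(* The stress annihilates linear functions and [psi], which is affine and zero at [p i];
   [lam_symmetric] reduces the remaining mixed term to [- c * J]. Hence the form of [f] is that of
   [chi] minus [c ^+ 2 * J]. *)
have JQ : \sum_j lam chi i j * chi j =
    \sum_j lam f i j * (f j - f i) + c ^+ 2 * J.
  transitivity (\sum_j lam f i j * chi j - c * \sum_j lam psi i j * chi j).
    by rewrite mulr_sumr -sumrB; apply: eq_bigr => j _; rewrite lamchi; ring.
  rewrite -(lam_symmetric chi0 psi0).
  have -> : \sum_j lam chi i j * psi j = \sum_j lam f i j * psi j - c * J.
    rewrite /J mulr_sumr -sumrB.
    by apply: eq_bigr => j _; rewrite lamchi; ring.
  have -> : \sum_j lam f i j * chi j = \sum_j lam f i j * (f j - f i)
      - c * \sum_j lam f i j * psi j - \sum_j lam f i j * dot l (p j - p i).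
    rewrite mulr_sumr -!sumrB; apply: eq_bigr => j _.
    by rewrite /chi dotBr li; ring.
  by rewrite psi_stress stress; ring.
have J0 : 0 < J.
  have term j : 0 <= lam psi i j * psi j.
    have [->|/psi_gt0/ltW] := eqVneq j i; first by rewrite psi0 mulr0.
    by apply: mulr_ge0; exact: lam_psi_ge0.
  rewrite lt_def sumr_ge0 // andbT; apply/eqP => z.
  have [|j] := lam_psi_gt0 psi0 psi_gt0 (e := e).
    by exists j1, k1; split => //; rewrite gt_eqF.
  have [->|ji] := eqVneq j i.
    by rewrite lam0 ?eqxx // => k; apply/negP => /T_neq[]; rewrite eqxx.
  have /eqP := psumr_eq0P (fun j (_ : xpredT j) => term j) z (i := j) isT.
  by rewrite mulf_eq0 (gt_eqF (psi_gt0 _ ji)) orbF => ->.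
have cJ : 0 <= c ^+ 2 * J by rewrite mulr_ge0 ?sqr_ge0 // ltW.
split; first by lra.
move=> Q0 j k j' k' ijk ijk'.
have c0 : c = 0.
  have /eqP : c ^+ 2 * J = 0 by lra.
  by rewrite mulf_eq0 (gt_eqF J0) orbF expf_eq0 => /eqP.
have Jchi : \sum_j lam chi i j * chi j = 0 by rewrite JQ Q0 c0; ring.
have := J2 Jchi _ _ ijk; have := J2 Jchi _ _ ijk'.
rewrite !tchi // c0; lra.
Qed.

End Vertex.

(* The edge directions at [p i] positively span minus [p i]: the origin is an
   interior point. *)
Let max_ge0 i w : (forall j k, T i j k ->
    dot w (p j) <= dot w (p i) /\ dot w (p k) <= dot w (p i)) ->
  0 <= dot w (p i).
Proof.
move=> wmax; have [u [ui ult]] := p_exposed i; pose psi a := 1 - dot u (p a).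
have psi0 : psi i = 0 by rewrite /psi ui subrr.
have psi_gt0 j : j != i -> 0 < psi j by move=> /ult; rewrite subr_gt0.
have [a [b [iab _ _]]] := vertex_star i 0.
pose e := p a; have e0 : cross (p i) e != 0 := cross_neq0 (lt0r_neq0 (T_pos iab)).
have e0' : cross (p i) (- e) != 0.
  by have -> : cross (p i) (- e) = - cross (p i) e; [vecring|rewrite oppr_eq0].
have [j [k [ijk y0 z0]]] := vertex_star i e.
have [j' [k' [ijk' y0' z0']]] := vertex_star i (- e).
have g := gradE psi e ijk; have g' := gradE psi (- e) ijk'.
have g0 := grad_psi_gt0 psi0 psi_gt0 e0 ijk y0 z0.
have g0' := grad_psi_gt0 psi0 psi_gt0 e0' ijk' y0' z0'.
have d0 := T_pos ijk; have d0' := T_pos ijk'.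
have c := cramer (p i) (p j) (p k) e; have c' := cramer (p i) (p j') (p k') (- e).
have [wj wk] := wmax _ _ ijk; have [wj' wk'] := wmax _ _ ijk'.
have uc := congr1 (dot u) c; have uc' := congr1 (dot u) c'.
have wc := congr1 (dot w) c; have wc' := congr1 (dot w) c'.
move: uc uc' wc wc' g g'.
set t := dot (grad _ _ _ _) _ in g0 *; set t' := dot (grad _ _ _ _) _ in g0' *.
rewrite !dotDr !dotZr !dotNr ui psi0 /psi.
set d := triple (p i) (p j) (p k) in d0 *.
set d' := triple (p i) (p j') (p k') in d0' *.
set x := triple (p j) _ _; set x' := triple (p j') _ _.
set y := triple (p k) _ _ in y0 *; set y' := triple (p k') _ _ in y0' *.
set z := triple (p i) (p j) _ in z0 *; set z' := triple (p i) (p j') _ in z0' *.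
set M := dot w (p i) in wj wk wj' wk' *.
move=> uc uc' wc wc' g g'.
(* Weighting the expansions of [e] and [- e] by [d'] and [d] cancels [e]. What remains is a
   nonnegative combination of edge vectors at [p i] that equals [p i] times minus the positive
   number bounded here. *)
have s0 : 0 < d' * (d * t) + d * (d' * t') by rewrite addr_gt0 ?mulr_gt0.
have r : 0 <= d' * (y * (M - dot w (p j)) + z * (M - dot w (p k)))
    + d * (y' * (M - dot w (p j')) + z' * (M - dot w (p k'))).
  by rewrite addr_ge0 ?mulr_ge0 ?addr_ge0 ?mulr_ge0 ?subr_ge0 // ltW.
rewrite -(pmulr_rge0 _ s0); apply: le_trans r _; rewrite le_eqVlt; apply/orP; left.
have s1 : d * t + d * dot u e = x + y + z by lra.
have s2 : d' * t' - d' * dot u e = x' + y' + z' by lra.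
have -> : y * (M - dot w (p j)) + z * (M - dot w (p k)) =
    (x + y + z) * M - d * dot w e by rewrite wc; ring.
have -> : y' * (M - dot w (p j')) + z' * (M - dot w (p k')) =
    (x' + y' + z') * M + d' * dot w e by rewrite -[d' * dot w e]opprK -mulrN wc'; ring.
by rewrite -s1 -s2; apply/eqP; ring.
Qed.

Lemma vertex_triangle i : exists j k, T i j k.
Proof. by have [j [k [ijk _ _]]] := vertex_star i 0; exists j, k. Qed.

(** * Motions of the triangles *)

Section Deformation.
Variable q : 'I_n -> V.
Hypothesis q_isometric :
  forall i j k, T i j k -> dot (p i - p j) (q i - q j) = 0.

Let f i := dot (q i) (p i).

Let om i j k : V := (triple (p i) (p j) (p k))^-1 *:
  (dot (q j - grad f i j k) (p k) *: p i + dot (q k - grad f i j k) (p i) *: p j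
   + dot (q i - grad f i j k) (p j) *: p k).

Let om_cyc i j k : om i j k = om j k i.
Proof.
by rewrite /om tripleC (grad_cyc f i) -addrA addrC.
Qed.

(** With [v] the gradient, [q a - v] is orthogonal to [p a] by the definition of [f], and isometry
    along the sides makes [p a |-> q a - v] skew. It is therefore a cross product, whose axis is
    [om], written in the basis of the vertices. *)
Let om_spec i j k : T i j k -> cross (om i j k) (p i) = q i - grad f i j k.
Proof.
move=> ijk; have d0 := lt0r_neq0 (T_pos ijk).
have [gi gj gk] := grad_dot f ijk.
have E x : dot (cross (om i j k) (p i)) x = (triple (p i) (p j) (p k))^-1 *
    (dot (q k - grad f i j k) (p i) * triple (p j) (p i) x
     + dot (q i - grad f i j k) (p j) * triple (p k) (p i) x).
  rewrite /om; move: (dot (q j - _) _) (dot (q k - _) _) (dot (q i - _) _) => b c d.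
  by move: (_^-1) => a; vring.
apply: (basis_ext d0); rewrite {}E.
- have -> : triple (p j) (p i) (p i) = 0 by vring.
  have -> : triple (p k) (p i) (p i) = 0 by vring.
  have -> : dot (q i - grad f i j k) (p i) = 0 by rewrite dotBl gi subrr.
  by rewrite !mulr0 addr0 mulr0.
- have -> : triple (p j) (p i) (p j) = 0 by vring.
  by rewrite (tripleC (p k)) mulr0 add0r mulrCA mulVf // mulr1.
- have -> : triple (p k) (p i) (p k) = 0 by vring.
  rewrite (tripleA (p j)) mulrN mulr0 addr0 mulrN mulrCA mulVf // mulr1.
  have : dot (p k - p i) (q k - q i) = 0 by apply: (@q_isometric _ _ j); rewrite T_cycr.
  rewrite !dotBl gi gk /f !dotBr !(dotC (p _)); lra.
Qed.

Lemma triangle_motion i j k : T i j k -> exists w v,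
  [/\ q i = cross w (p i) + v, q j = cross w (p j) + v & q k = cross w (p k) + v].
Proof.
move=> ijk; exists (om i j k), (grad f i j k); split.
- by rewrite om_spec // subrK.
- by rewrite om_cyc grad_cyc om_spec ?subrK // -T_cycr.
- by rewrite -om_cyc -grad_cyc om_spec ?subrK // T_cycr.
Qed.

Let om_jump i j k l : T i j k -> T j i l ->
  om i j k - om j i l = lam f i j *: (p j - p i).
Proof.
move=> ijk jil; have g := lamP f ijk jil.
have N0 := cross_neq0 (lt0r_neq0 (T_pos ijk)).
have jki : T j k i by rewrite -T_cycr.
have ilj : T i l j by rewrite -T_cycr.
apply/eqP; rewrite -subr_eq0; apply/eqP; apply: (cross_pair_eq0 N0).
- have -> (x y : V) (s : R) : cross (x - y - s *: (p j - p i)) (p i) =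
      cross x (p i) - cross y (p i) + s *: cross (p i) (p j) by vecring.
  rewrite om_spec // (om_cyc j) om_spec // -(grad_cyc f j) -g.
  by apply/colP => m; rewrite !mxE; ring.
- have -> (x y : V) (s : R) : cross (x - y - s *: (p j - p i)) (p j) =
      cross x (p j) - cross y (p j) + s *: cross (p i) (p j) by vecring.
  rewrite (om_cyc i) !om_spec // -(grad_cyc f i) -g.
  by apply/colP => m; rewrite !mxE; ring.
Qed.

Let lam_stress i w : \sum_j lam f i j * dot w (p j - p i) = 0.
Proof.
transitivity (\sum_j (1 : R) * (lam f i j * dot w (p j - p i))).
  by apply: eq_bigr => j _; rewrite mul1r.
rewrite (vertex_abel (i := i) (G := fun j k => dot w (om i j k))).
- by rewrite big1 // => j _; rewrite big1 // => k _; rewrite subrr mul0r.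
- by move=> j k l ijk jil; rewrite -dotZr -(om_jump ijk jil) dotBr (om_cyc j).
- by move=> j nj; rewrite lam0 ?mul0r.
Qed.

Let grad_star i j k j' k' : T i j k -> T i j' k' -> grad f i j k = grad f i j' k'.
Proof.
pose Q i := \sum_j lam f i j * (f j - f i).
have Q_le0 a : 0 <= - Q a.
  have [b [c [abc _ _]]] := vertex_star a 0.
  have e0 := cross_neq0 (lt0r_neq0 (T_pos abc)).
  by rewrite oppr_ge0; have [] := vertex_form e0 (lam_stress a).
have Q_sum : \sum_a - Q a = 0.
  rewrite sumrN; apply/eqP; rewrite oppr_eq0; apply/eqP.
  have : \sum_a Q a = - \sum_a Q a.
    transitivity (\sum_a \sum_b lam f b a * (f a - f b)).
      exact: exchange_big.
    rewrite -sumrN; apply: eq_bigr => a _; rewrite /Q -sumrN.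
    by apply: eq_bigr => b _; rewrite (lam_sym f b a); ring.
  by move: (\sum_a Q a) => x; lra.
have /eqP Q0 := psumr_eq0P (fun a (_ : xpredT a) => Q_le0 a) Q_sum (i := i) isT.
rewrite oppr_eq0 in Q0; move/eqP: Q0 => Q0 ijk ijk'.
(* The difference of the two gradients is its own test direction: equal derivatives along [e] give
   [dot e e = 0]. Being orthogonal to [p i], it is parallel to [p i] only if it is zero. *)
pose e := grad f i j k - grad f i j' k'.
have [g1 _ _] := grad_dot f ijk; have [g2 _ _] := grad_dot f ijk'.
have ei : dot e (p i) = 0 by rewrite dotBl g1 g2 subrr.
have p0 : p i != 0.
  have [w [+ _]] := p_exposed i; apply: contra_eqN => /eqP ->.
  by rewrite dot0r eq_sym oner_eq0.
apply/eqP; rewrite -subr_eq0 -/e; apply/eqP.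
have [/eqP ce|ce] := boolP (cross (p i) e == 0); first exact: cross_ortho_eq0 ei ce.
have [_ /(_ Q0 _ _ _ _ ijk ijk') /eqP] := vertex_form ce (lam_stress i).
by rewrite -subr_eq0 -dotBl dot_eq0 => /eqP.
Qed.

(** If a vertex [k] were left out, the functional exposing [p k], maximised over the vertices
    already reached, would have a local maximum on the surface, as the neighbours of a reached
    vertex are reached. By convexity a local maximum is global, which [p k] contradicts. *)
Theorem radial_linear : exists w, forall i, dot (q i) (p i) = dot w (p i).
Proof.
have [i0 [j0 [k0 [T0 _ _ _]]]] := T_cover 0.
pose w := grad f i0 j0 k0.
pose C i := `[< forall j k, T i j k -> grad f i j k = w >].
have C_star i j k : T i j k -> grad f i j k = w -> C i.
  by move=> ijk wE; apply/asboolP => j' k' ijk'; rewrite -wE; exact: grad_star.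
have C_all k : C k.
  have [//|nCk] := boolP (C k); exfalso; have [u [uk ult]] := p_exposed k.
  have := C_star _ _ _ T0 erefl => Ci0.
  case: (Order.TotalTheory.arg_maxP (fun i => dot u (p i)) Ci0) => i Ci imax.
  have ik : i != k by apply: contraTneq Ci => ->.
  have nb j l : T i j l -> dot u (p j) <= dot u (p i) /\ dot u (p l) <= dot u (p i).
    move=> ijl; have wijl : grad f i j l = w by move/asboolP : Ci; apply.
    split; apply: imax.
      by apply: (C_star j l i); [rewrite -T_cycr|rewrite -grad_cyc].
    by apply: (C_star l i j); [rewrite T_cycr|rewrite grad_cyc].
  have M0 := max_ge0 nb; have M1 := ult _ ik.
  have [j [l [ijl y0 z0]]] := vertex_star i (p k).
  have [uj ul] := nb _ _ ijl; have [v [vi vj vl vle]] := T_face ijl.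
  have d0 := T_pos ijl; have c := cramer (p i) (p j) (p l) (p k).
  have := congr1 (dot v) c; have := congr1 (dot u) c; have := vle k.
  rewrite !dotDr !dotZr uk vi vj vl !mulr1.
  set d := triple (p i) _ _ in d0 *; set x := triple (p j) _ _.
  set y := triple (p l) _ _ in y0 *; set z := triple (p i) (p j) _ in z0 *.
  move=> vk ucd vcd.
  (* The supporting plane bounds [x + y + z] although [x] may be negative; since the maximum is
     nonnegative by [M0], the inequalities chain to [d <= d * dot u (p i)], against [M1]. *)
  have s : x + y + z <= d by rewrite -vcd ler_piMr // ltW.
  have sM : (x + y + z) * dot u (p i) <= d * dot u (p i) by rewrite ler_wpM2r.
  have dM : d * dot u (p i) < d * 1 by rewrite ltr_pM2l.
  have yj : y * dot u (p j) <= y * dot u (p i) by rewrite ler_wpM2l.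
  have zl : z * dot u (p l) <= z * dot u (p i) by rewrite ler_wpM2l.
  lra.
exists w => i; have [j [k [ijk _ _]]] := vertex_star i 0.
have /asboolP/(_ _ _ ijk) <- := C_all i.
by have [-> _ _] := grad_dot f ijk.
Qed.

End Deformation.

End Fan.

(** * Faces of polyhedra *)

Section Convex.
Variable R : realType.
Local Notation V := 'cV[R]_3.
Implicit Types (P F : set V) (a b c o u v w x y z : V) (s t : R).

Lemma noncollinearP a b c : noncollinear a b c <-> cross (b - a) (c - a) != 0.
Proof.
rewrite /noncollinear free_cons span_seq1 seq1_free; set x := b - a; set y := c - a.
split.
  move=> /andP[xy y0]; apply: contraNN xy => /eqP xy; apply/vlineP.
  exists (dot x y / dot y y); apply: (scalerI (lt0r_neq0 (dot_gt0 y0))).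
  rewrite scalerA mulrCA divff ?mulr1 ?dot_eq0 //.
  apply/eqP; rewrite -subr_eq0; apply/eqP.
  have := cross_cross y x y; rewrite xy; have -> : cross y 0 = 0 by vecring.
  by rewrite (dotC y x) => <-.
move=> xy; apply/andP; split; apply: contraNN xy.
  by move=> /vlineP[s ->]; apply/eqP; vecring.
by move=> /eqP ->; apply/eqP; vecring.
Qed.

Lemma nbhs_direction (A : set V) o v : nbhs o A -> exists2 s, 0 < s & A (o + s *: v).
Proof.
move=> oA; have : (fun s : R => o + s *: v) @ (0 : R) --> o.
  rewrite -[X in _ --> X]addr0 -[X in _ + X](scale0r v).
  by apply: cvgD; [exact: cvg_cst|apply: cvgZr_tmp; exact: cvg_id].
move=> /(_ _ oA) /= /nbhs_ballP[r /= r0 rA]; exists (r / 2).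
  by rewrite divr_gt0.
by apply: rA; rewrite /ball /= sub0r normrN ger0_norm; lra.
Qed.

Lemma orthogonal_frame u : u != 0 ->
  exists a b, [/\ dot u a = 0, dot u b = 0 & cross a b != 0].
Proof.
move=> u0; suff [a [a0 ua]] : exists a, a != 0 /\ dot u a = 0.
  exists a, (cross u a); split=> //; first by vring.
  rewrite cross_cross (dotC a u) ua scale0r subr0.
  by rewrite scaler_eq0 dot_eq0 negb_or a0.
pose e (r s t : R) : V := \col_(i < 3) nth 0 [:: r; s; t] i.
pose i0 := @Ordinal 3 0 isT; pose i1 := @Ordinal 3 1 isT.
have [uxy|uxy] := eqVneq (e (- u i1 0) (u i0 0) 0) 0.
  exists (e 1 0 0); split.
    by apply/eqP => /colP /(_ i0); rewrite !mxE /=; lra.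
  have := congr1 (fun f : V => f i1 0) uxy.
  by rewrite dotE !mxE /= => ->; ring.
by exists (e (- u i1 0) (u i0 0) 0); split => //; rewrite dotE !mxE /=; ring.
Qed.

Lemma segmentC x y : segment x y = segment y x.
Proof.
suff h a b : segment a b `<=` segment b a by apply/seteqP; split; exact: h.
move=> z [t [t0 t1 ->]]; exists (1 - t); split; [lra|lra|].
by rewrite addrC; congr (_ *: _ + _ *: _); ring.
Qed.

Lemma interior_lt P o u s : interior P o -> u != 0 ->
  (forall x, P x -> dot u x <= s) -> dot u o < s.
Proof.
move=> oP u0 uP; have [t t0 /uP] := nbhs_direction u oP.
by rewrite dotDr dotZr; have := mulr_gt0 t0 (dot_gt0 u0); lra.
Qed.

Lemma face_functional P F o : interior P o -> proper_face P F -> exists w,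
  (forall x, P x -> dot w (x - o) <= 1) /\
  (forall x, F x <-> P x /\ dot w (x - o) = 1).
Proof.
move=> oP [u [s [u0 uP ->]]]; have so := interior_lt oP u0 uP.
have d0 : 0 < s - dot u o by rewrite subr_gt0.
exists ((s - dot u o)^-1 *: u); split=> x.
  move=> /uP ux; rewrite dotZl mulrC ler_pdivrMr // mul1r dotBr; lra.
rewrite dotZl dotBr; split=> [[Px /= ->]|[Px e]]; first by rewrite mulVf ?lt0r_neq0.
split=> //=; have := congr1 ( *%R (s - dot u o)) e.
by rewrite mulrA divff ?lt0r_neq0 // mul1r mulr1; lra.
Qed.

Lemma compact_ray P o x : compact P -> x != 0 -> exists2 t, 0 < t & ~ P (o + t *: x).
Proof.
move=> /compact_bounded[M [_ PM]] x0; have nx : 0 < `|x| by rewrite normr_gt0.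
have {}PM y : P y -> `|y| <= `|M| + 1.
  by apply: PM; have := ler_norm M; lra.
have M0 : 0 < `|M| + 1 + `|o| + 1 by rewrite ltr_wpDl // !addr_ge0.
exists ((`|M| + 1 + `|o| + 1) / `|x|) => [|/PM]; first by rewrite divr_gt0.
set t := _ / _; have tx : `|t *: x| = `|M| + 1 + `|o| + 1.
  by rewrite normrZ gtr0_norm ?divr_gt0 // /t divfK ?gt_eqF.
have := ler_normB (o + t *: x) o; rewrite (addrC o) addrK tx; lra.
Qed.

(** Take a set of constraints of least size: dropping [k] admits a point outside [P], and that point
    violates [k] alone. *)
Lemma irredundant P m (u : 'I_m -> V) (c : 'I_m -> R) :
  P = [set x | forall k, dot (u k) x <= c k] ->
  exists K : {set 'I_m}, P = [set x | forall k, k \in K -> dot (u k) x <= c k] /\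
    forall k, k \in K -> exists z, c k < dot (u k) z /\
      forall l, l \in K -> l != k -> dot (u l) z <= c l.
Proof.
move=> PE; pose good (K : {set 'I_m}) :=
  `[< P = [set x | forall k, k \in K -> dot (u k) x <= c k] >].
have good_all : good [set: 'I_m]%SET.
  apply/asboolP; rewrite PE; apply/seteqP; split=> x /= h k.
    by move=> _; exact: h.
  by apply: h; rewrite finset.in_setT.
case: (arg_minnP (fun K : {set 'I_m} => #|K|) good_all) => K /asboolP KE Kmin.
exists K; split=> // k kK; apply: contrapT => nz.
suff /Kmin : good (K :\ k)%SET by rewrite [in X in (X <= _)%N](cardsD1 k) kK ltnn.
apply/asboolP; rewrite KE; apply/seteqP; split=> x /= h l.
  by rewrite !inE => /andP[_]; exact: h.
have [->|lk lK] := eqVneq l k; last by apply: h; rewrite !inE lk.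
move=> _; rewrite leNgt; apply/negP => kx; apply: nz; exists x; split=> // j jK jk.
by apply: h; rewrite !inE jk.
Qed.

(** The segment from [o] to [z] crosses the plane of [k] at a point where all other constraints are
    strict, so a small piece of the plane around it lies in [P]. *)
Lemma facet_of_constraint P m (u : 'I_m -> V) (c : 'I_m -> R) (K : {set 'I_m}) k o :
  (forall k, u k != 0) -> interior P o ->
  P = [set x | forall k, k \in K -> dot (u k) x <= c k] -> k \in K ->
  (exists z, c k < dot (u k) z /\ forall l, l \in K -> l != k -> dot (u l) z <= c l) ->
  is_facet P (P `&` [set x | dot (u k) x = c k]).
Proof.
move=> u0 oP PE kK [z [kz lz]].
have slack l : l \in K -> dot (u l) o < c l.
  by move=> lK; apply: (interior_lt oP (u0 l)) => x; rewrite PE; apply.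
split; first by exists (u k), (c k); split=> // x; rewrite PE; apply.
have [a [b [ua ub ab]]] := orthogonal_frame (u0 k).
have ok := slack k kK; pose t := (c k - dot (u k) o) / (dot (u k) z - dot (u k) o).
have d0 : 0 < dot (u k) z - dot (u k) o by lra.
have t0 : 0 < t by rewrite divr_gt0 // subr_gt0.
have t1 : t < 1 by rewrite ltr_pdivrMr //; lra.
pose y := o + t *: (z - o).
have yk : dot (u k) y = c k.
  by rewrite dotDr dotZr dotBr /t divfK ?gt_eqF //; lra.
have yl l : l \in K -> l != k -> dot (u l) y < c l.
  move=> lK lk; rewrite dotDr dotZr dotBr.
  have h1 : 0 < (1 - t) * (c l - dot (u l) o) by rewrite mulr_gt0 ?subr_gt0 ?slack.
  have h2 : 0 <= t * (c l - dot (u l) z) by rewrite mulr_ge0 ?(ltW t0) // subr_ge0 lz.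
  lra.
pose Q l s := l \in K -> l != k ->
  dot (u l) (y + s *: a) <= c l /\ dot (u l) (y + s *: b) <= c l.
have [s s0 sQ] : exists2 s, 0 < s & forall l, Q l s.
  apply: fin_eventually => l; have [lK|lK] := boolP (l \in K); last first.
    by exists 1 => // s _; rewrite /Q (negbTE lK).
  have [lk|lk] := eqVneq l k; first by exists 1 => // s _; rewrite /Q lk eqxx.
  have yc := yl l lK lk; pose M := `|dot (u l) a| + `|dot (u l) b| + 1.
  have M0 : 0 < M by rewrite ltr_wpDl ?addr_ge0.
  exists ((c l - dot (u l) y) / M); first by rewrite divr_gt0 // subr_gt0.
  move=> s /andP[s0]; rewrite ler_pdivlMr // /M => sM _ _.
  have sa : s * dot (u l) a <= s * `|dot (u l) a| by rewrite ler_wpM2l ?ler_norm // ltW.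
  have sb : s * dot (u l) b <= s * `|dot (u l) b| by rewrite ler_wpM2l ?ler_norm // ltW.
  have na := mulr_ge0 (ltW s0) (normr_ge0 (dot (u l) a)).
  have nb := mulr_ge0 (ltW s0) (normr_ge0 (dot (u l) b)).
  by rewrite !(dotDr y) !dotZr; split; lra.
have inF v : dot (u k) v = 0 ->
    (forall l, l \in K -> l != k -> dot (u l) (y + s *: v) <= c l) ->
    (P `&` [set x | dot (u k) x = c k]) (y + s *: v).
  move=> uv h; have e : dot (u k) (y + s *: v) = c k.
    by rewrite dotDr dotZr yk uv mulr0 addr0.
  split=> //; rewrite PE => l lK; have [->|lk] := eqVneq l k; first by rewrite e.
  exact: h.
exists (y + s *: 0), (y + s *: a), (y + s *: b); split.
- by apply: inF => [|l lK lk]; rewrite ?dot0r // scaler0 addr0 ltW // yl.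
- by apply: inF => // l lK lk; have [] := sQ l lK lk.
- by apply: inF => // l lK lk; have [] := sQ l lK lk.
apply/noncollinearP.
have -> : cross (y + s *: a - (y + s *: 0)) (y + s *: b - (y + s *: 0)) =
  (s * s) *: cross a b by vecring.
by rewrite scaler_eq0 mulf_eq0 !gt_eqF.
Qed.

(** The ray leaves [P] at the constraint with the largest ratio [r], the inverse of the hitting
    time; compactness ensures that some constraint is hit. *)
Lemma ray_meets_facet P o x : convex_polyhedron P -> compact P -> interior P o ->
  x != 0 -> exists2 s, 0 < s & exists2 F, is_facet P F & F (o + s *: x).
Proof.
move=> [m [u [c [u0 PE]]]] Pc oP x0.
have [K [KE Kz]] := irredundant PE.
have slack l : l \in K -> 0 < c l - dot (u l) o.
  move=> lK; rewrite subr_gt0; apply: (interior_lt oP (u0 l)) => y.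
  by rewrite KE; apply.
have [t t0 nP] := compact_ray o Pc x0.
have [k kK kx] : exists2 k, k \in K & 0 < dot (u k) x.
  apply: contrapT => none; apply: nP; rewrite KE => l lK.
  have : ~~ (0 < dot (u l) x) by apply/negP => ?; apply: none; exists l.
  rewrite -leNgt dotDr dotZr => h; have := slack l lK; nra.
pose r l := dot (u l) x / (c l - dot (u l) o).
case: (Order.TotalTheory.arg_maxP r kK) => l lK lmax.
have rl : 0 < r l.
  by apply: lt_le_trans (lmax k kK); rewrite divr_gt0 ?slack.
have rE j : j \in K -> dot (u j) x = r j * (c j - dot (u j) o).
  by move=> jK; rewrite divfK // gt_eqF // slack.
exists (r l)^-1; first by rewrite invr_gt0.
exists (P `&` [set x | dot (u l) x = c l]).
  exact: (facet_of_constraint u0 oP KE lK (Kz l lK)).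
split.
  rewrite KE => j jK; rewrite dotDr dotZr (rE j jK) mulrA.
  have h : (r l)^-1 * r j <= 1 by rewrite mulrC ler_pdivrMr // mul1r; exact: lmax.
  have := slack j jK; nra.
by rewrite /= dotDr dotZr (rE l lK) mulrA mulVf ?gt_eqF // mul1r; ring.
Qed.

End Convex.

(** * The fan of a subdivided polyhedron *)

Section Polyhedron.
Variable R : realType.
Local Notation V := 'cV[R]_3.
Variables (P : set V) (n : nat) (p : 'I_n -> V) (D : rel 'I_n) (o : V).
Hypothesis P_polyhedron : convex_polyhedron P.
Hypothesis P_compact : compact P.
Hypothesis o_interior : interior P o.
Hypothesis p_vertices : enumerates_vertices P p.
Hypothesis D_subdivision : subdivides_faces P p D.
Implicit Types (i j k l a b c : 'I_n) (F : set V) (g : 'I_n -> R).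

Let r i := p i - o.

Let side i j := is_edge P (p i) (p j) \/ D i j.

(* The triangles of the subdivision, counterclockwise as seen from outside. *)
Let T i j k := `[< 0 < triple (r i) (r j) (r k) /\ exists F,
  [/\ is_facet P F, [/\ F (p i), F (p j) & F (p k)]
    & [/\ side i j, side j k & side k i]] >].

Let side_sym i j : side i j -> side j i.
Proof.
have [D_sym _ _ _] := D_subdivision.
case=> [[ij e]|Dij]; last by right; rewrite D_sym.
by left; split; [exact: nesym|rewrite segmentC].
Qed.

Let p_inj : injective p. Proof. by case: p_vertices. Qed.

Let p_vertex i : is_vertex P (p i).
Proof. by case: p_vertices => _ e; have : range p (p i) by []; rewrite e. Qed.

Let T_cyc i j k : T i j k -> T j k i.
Proof.
move=> /asboolP[d [F [fF [Fi Fj Fk] [ij jk ki]]]]; apply/asboolP.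
by split; [rewrite -tripleC|exists F].
Qed.

Let T_pos i j k : T i j k -> 0 < triple (r i) (r j) (r k).
Proof. by move=> /asboolP[]. Qed.

Let p_in_P i : P (p i).
Proof.
by have [u [s [_ _ e]]] := p_vertex i; have : [set p i] (p i) by []; rewrite e => -[].
Qed.

Let r_exposed i : exists w, dot w (r i) = 1 /\ forall j, j != i -> dot w (r j) < 1.
Proof.
have [w [wP wE]] := face_functional o_interior (p_vertex i).
exists w; split=> [|j ji]; first by have /wE[] : [set p i] (p i) by [].
rewrite lt_neqAle wP // andbT; apply: contraNN ji => /eqP e.
by apply/eqP/p_inj; apply/wE; split.
Qed.

Let T_facet i j k : T i j k -> exists F w, [/\ is_facet P F,
  forall x, P x -> dot w (x - o) <= 1,
  forall x, F x <-> P x /\ dot w (x - o) = 1 &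
  forall a, a \in [:: i; j; k] -> dot w (r a) = 1].
Proof.
move=> /asboolP[_ [F [fF [Fi Fj Fk] _]]].
have [w [wP wE]] := face_functional o_interior fF.1.
exists F, w; split=> // a; rewrite !inE => /or3P[]/eqP ->.
- by have /wE[] := Fi.
- by have /wE[] := Fj.
- by have /wE[] := Fk.
Qed.

Let T_face i j k : T i j k -> exists w, [/\ dot w (r i) = 1, dot w (r j) = 1,
  dot w (r k) = 1 & forall a, dot w (r a) <= 1].
Proof.
move=> /T_facet[F [w [fF wP wE h]]]; exists w.
by split=> [|||a]; last exact: wP; rewrite h // !inE eqxx ?orbT.
Qed.

Let T_side i j k a b : T i j k -> a \in [:: i; j; k] -> b \in [:: i; j; k] ->
  a != b -> side a b.
Proof.
move=> /asboolP[_ [F [_ _ [ij jk ki]]]]; rewrite !inE.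
move=> /or3P[]/eqP -> /or3P[]/eqP ->; rewrite ?eqxx // => _; exact: side_sym.
Qed.

Let T_cover x : exists i j k, [/\ T i j k, 0 <= triple (r j) (r k) x,
  0 <= triple (r k) (r i) x & 0 <= triple (r i) (r j) x].
Proof.
have [D_sym _ _ D_cover] := D_subdivision.
wlog x0 : x / x != 0 => [h|].
  (* At 0 all the conditions are equalities, so any triangle serves; an arbitrary nonzero vector
     provides one. *)
  have [->|] := eqVneq x 0; last exact: h.
  have [i [j [k [ijk _ _ _]]]] : exists i j k, [/\ T i j k,
      0 <= triple (r j) (r k) (const_mx 1), 0 <= triple (r k) (r i) (const_mx 1)
      & 0 <= triple (r i) (r j) (const_mx 1)].
    by apply: h; apply/eqP => /colP/(_ 0)/eqP; rewrite !mxE oner_eq0.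
  by exists i, j, k; split; rewrite // le_eqVlt; apply/orP; left; apply/eqP; vring.
have [s s0 [F fF Fx]] := ray_meets_facet P_polyhedron P_compact o_interior x0.
have [i [j [k [[Fi Fj Fk] nc [ij jk ki] xF]]]] := D_cover F _ fF Fx.
have [t1 [t2 [t3 [h1 h2 h3 ts xE]]]] := xF.
have [w [wP wE]] := face_functional o_interior fF.1.
have [/wE[_ wi] /wE[_ wj] /wE[_ wk]] := And3 Fi Fj Fk.
have d0 : triple (r i) (r j) (r k) != 0.
  move/noncollinearP: nc; apply: contraNN => /eqP d0; apply/eqP.
  have := cramer_dual (r i) (r j) (r k) w; rewrite d0 scale0r wi wj wk !scale1r => e.
  rewrite e; vecring.
have {xE} xE : x = (t1 / s) *: r i + (t2 / s) *: r j + (t3 / s) *: r k.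
  have : s *: x = t1 *: r i + t2 *: r j + t3 *: r k.
    transitivity (o + s *: x - (t1 + t2 + t3) *: o).
      by rewrite ts scale1r addrC addKr.
    by rewrite xE /r; apply/colP => m; rewrite !mxE; ring.
  move=> /(congr1 ( *:%R s^-1)); rewrite scalerA mulVf ?gt_eqF // scale1r => ->.
  by apply/colP => m; rewrite !mxE; ring.
have c1 : 0 <= t1 / s by rewrite divr_ge0 // ltW.
have c2 : 0 <= t2 / s by rewrite divr_ge0 // ltW.
have c3 : 0 <= t3 / s by rewrite divr_ge0 // ltW.
have E1 : triple (r j) (r k) x = t1 / s * triple (r i) (r j) (r k) by rewrite xE; vring.
have E2 : triple (r k) (r i) x = t2 / s * triple (r i) (r j) (r k) by rewrite xE; vring.
have E3 : triple (r i) (r j) x = t3 / s * triple (r i) (r j) (r k) by rewrite xE; vring.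
have [dn|dp|/esym/eqP] := ltrgtP 0 (triple (r i) (r j) (r k));
  last by rewrite (negbTE d0).
- exists i, j, k; rewrite E1 E2 E3 !(mulr_ge0 _ (ltW dn)) //; split=> //.
  by apply/asboolP; split => //; exists F.
have tr a b y : triple (r a) (r b) y = - triple (r b) (r a) y by exact: tripleA.
have dN : 0 <= - triple (r i) (r j) (r k) by rewrite oppr_ge0 ltW.
(* A triangle listed clockwise is reversed. *)
exists i, k, j; rewrite (tr k j) (tr j i) (tr i k) E1 E2 E3 -!mulrN !(mulr_ge0 _ dN) //.
split=> //.
apply/asboolP; split; last by exists F; split=> //; split; exact: side_sym.
by rewrite -(tripleC (r j)) tr tripleC -tripleC oppr_gt0.
Qed.

Let dot_dep w g : \sum_a g a *: r a = 0 ->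
  \sum_a g a * (1 - dot w (r a)) = \sum_a g a.
Proof.
move=> dep; have := congr1 (dot w) dep; rewrite dot_sumr dot0r => e.
transitivity (\sum_a g a - \sum_a dot w (g a *: r a)); last by rewrite e subr0.
by rewrite -sumrB; apply: eq_bigr => a _; rewrite dotZr; ring.
Qed.

(** The total of [g] equals the sum of [g a * (1 - dot w (r a))], where positive coefficients sit on
    the face and contribute 0, and the others contribute at most 0. *)
Let face_balance w g (S : seq 'I_n) : \sum_a g a *: r a = 0 ->
  (forall a, dot w (r a) <= 1) -> (forall a, a \in S -> dot w (r a) = 1) ->
  (forall a, 0 < g a -> a \in S) ->
  \sum_a g a <= 0 /\ (\sum_a g a = 0 -> forall a, g a != 0 -> dot w (r a) = 1).
Proof.
move=> dep w1 wS gS.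
have term a : 0 <= - (g a * (1 - dot w (r a))).
  have [ga|ga] := ltP 0 (g a); first by rewrite wS ?gS // subrr mulr0 oppr0.
  by rewrite -mulNr mulr_ge0 ?oppr_ge0 // subr_ge0.
have E : \sum_a - (g a * (1 - dot w (r a))) = - \sum_a g a.
  by rewrite sumrN (dot_dep w dep).
split; first by rewrite -oppr_ge0 -E sumr_ge0.
move=> z a ga; rewrite z oppr0 in E.
have /eqP := psumr_eq0P (fun b (_ : xpredT b) => term b) E (i := a) isT.
by rewrite oppr_eq0 mulf_eq0 (negbTE ga) subr_eq0 => /eqP.
Qed.

(** Otherwise the exposed point [r a] would be a convex combination of other vertices. *)
Let other_positive g a : \sum_b g b *: r b = 0 -> \sum_b g b = 0 -> 0 < g a ->
  exists2 b, b != a & 0 < g b.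
Proof.
move=> dep g0 ga; apply: contrapT => none.
have neg b : b != a -> g b <= 0.
  by move=> ba; rewrite leNgt; apply/negP => gb; apply: none; exists b.
have [w [wa wlt]] := r_exposed a.
have term b : 0 <= - (g b * (1 - dot w (r b))).
  have [->|ba] := eqVneq b a; first by rewrite wa subrr mulr0 oppr0.
  by rewrite -mulNr mulr_ge0 ?oppr_ge0 ?neg // subr_ge0 ltW ?wlt.
have E : \sum_b - (g b * (1 - dot w (r b))) = 0.
  by rewrite sumrN (dot_dep w dep) g0 oppr0.
move: g0; rewrite (bigD1 a) //= big1 ?addr0 => [z|b ba]; first by rewrite z ltxx in ga.
have /eqP := psumr_eq0P (fun b (_ : xpredT b) => term b) E (i := b) isT.
rewrite oppr_eq0 mulf_eq0 subr_eq0 => /orP[/eqP //|/eqP e].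
by have := wlt b ba; rewrite -e ltxx.
Qed.

Let segment_vertex a b c : segment (p a) (p b) (p c) -> c = a \/ c = b.
Proof.
move=> [t [t0 t1 e]]; have [w [wc wlt]] := r_exposed c.
have [->|ac] := eqVneq a c; first by left.
have [->|bc] := eqVneq b c; first by right.
have wa := wlt _ ac; have wb := wlt _ bc; exfalso.
have : r c = (1 - t) *: r a + t *: r b.
  by rewrite /r e; apply/colP => m; rewrite !mxE; ring.
move=> /(congr1 (dot w)); rewrite wc dotDr !dotZr => h.
have [t00|tn0] := eqVneq t 0; first by rewrite t00 in h; lra.
have tp : 0 < t by rewrite lt_def tn0.
have h1 : 0 < t * (1 - dot w (r b)) by rewrite mulr_gt0 // subr_gt0.
have h2 : 0 <= (1 - t) * (1 - dot w (r a)) by rewrite mulr_ge0 // subr_ge0 // ltW.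
lra.
Qed.

(** An edge is a face, so it contains a segment of [P] as soon as it contains an inner point of
    it. *)
Let edge_crossing a b c d x : is_edge P (p a) (p b) ->
  open_segment (p a) (p b) x -> open_segment (p c) (p d) x -> c = a \/ c = b.
Proof.
move=> [_ [u [s [u0 uP uE]]]] [t [t0 t1 xE]] [t' [t0' t1' xE']].
apply: segment_vertex; rewrite uE; split=> //=.
have : segment (p a) (p b) x by exists t; rewrite !ltW.
rewrite uE => -[_]; rewrite /mkset xE' dotDr !dotZr => e.
have uc := uP _ (p_in_P c); have ud := uP _ (p_in_P d).
have h1 : 0 <= t' * (s - dot u (p d)) by rewrite mulr_ge0 ?subr_ge0 // ltW.
have h2 : 0 <= (1 - t') * (s - dot u (p c)) by rewrite mulr_ge0 ?subr_ge0 // ltW.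
have /eqP : (1 - t') * (s - dot u (p c)) = 0 by lra.
by rewrite mulf_eq0 subr_eq0 (gt_eqF t1') /= subr_eq0 => /eqP.
Qed.

Let side_crossing F a b c d x : is_facet P F ->
  F (p a) -> F (p b) -> F (p c) -> F (p d) -> side a b -> side c d ->
  open_segment (p a) (p b) x -> open_segment (p c) (p d) x ->
  c \in [:: a; b] \/ a \in [:: c; d].
Proof.
have [_ _ D_noncross _] := D_subdivision.
move=> fF Fa Fb Fc Fd [eab|Dab] cd xab xcd.
  left; have [->|->] := edge_crossing eab xab xcd; rewrite !inE eqxx ?orbT //.
case: cd => [ecd|Dcd].
  right; have [->|->] := edge_crossing ecd xcd xab; rewrite !inE eqxx ?orbT //.
have [e|e] := D_noncross F a b c d fF Fa Fb Fc Fd Dab Dcd.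
  have : segment (p a) (p b) (p c).
    by rewrite e; exists 0; split; rewrite // subr0 scale1r scale0r addr0.
  by move=> /segment_vertex[->|->]; left; rewrite !inE eqxx ?orbT.
by have : (open_segment (p a) (p b) `&` open_segment (p c) (p d)) x by []; rewrite e.
Qed.

Let sum_four (W : zmodType) (v : 'I_n -> W) a a' b b' : uniq [:: a; a'; b; b'] ->
  (forall c, c \notin [:: a; a'; b; b'] -> v c = 0) ->
  \sum_c v c = v a + v a' + v b + v b'.
Proof.
move=> un v0; rewrite (bigID (mem [:: a; a'; b; b'])) /= [X in _ + X]big1 // addr0.
by rewrite -big_uniq //= !big_cons big_nil addr0 !addrA.
Qed.

(** Divided by its positive mass [s], the dependency becomes a common point of the open segments
    [a a'] and [b b']. Both are sides, and [on_face] places them in one facet. *)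
Let no_crossing i j k i' j' k' a a' b b' g : T i j k -> T i' j' k' ->
  \sum_c g c *: r c = 0 -> \sum_c g c = 0 ->
  [/\ a \in [:: i; j; k], a' \in [:: i; j; k], 0 < g a, 0 < g a' & a != a'] ->
  [/\ b \in [:: i'; j'; k'], b' \in [:: i'; j'; k'], g b < 0, g b' < 0 & b != b'] ->
  (forall F w, is_facet P F -> (forall x, P x -> dot w (x - o) <= 1) ->
    (forall c, c \in [:: i; j; k] -> dot w (r c) = 1) ->
    forall c, g c != 0 -> dot w (r c) = 1) ->
  (forall c, c \notin [:: a; a'; b; b'] -> g c = 0) -> False.
Proof.
move=> ijk ijk' dep g0 [ai ai' ga ga' aa'] [bi bi' gb gb' bb'] on_face supp.
have ne c d : 0 < g c -> g d < 0 -> c != d.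
  by move=> gc gd; apply: contraTneq gc => ->; rewrite -leNgt ltW.
have un : uniq [:: a; a'; b; b'].
  by rewrite /= !inE !negb_or aa' bb' !ne.
have [F [w [fF wP wE wS]]] := T_facet ijk.
have onF c : g c != 0 -> F (p c).
  by move=> gc; apply/wE; split=> //; exact: (on_face F w).
pose s := g a + g a'; have s0 : 0 < s by rewrite addr_gt0.
have sb : s = - (g b + g b').
  by move: g0; rewrite (sum_four un supp) /s; lra.
pose x := (g a / s) *: p a + (g a' / s) *: p a'.
have xab : open_segment (p a) (p a') x.
  exists (g a' / s); rewrite divr_gt0 // ltr_pdivrMr // mul1r ltrDr ga; split => //.
  rewrite /x; congr (_ *: _ + _); rewrite -[1](divff (lt0r_neq0 s0)) -mulrBl /s.
  by congr (_ / _); ring.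
have xcd : open_segment (p b) (p b') x.
  exists (- g b' / s); rewrite divr_gt0 ?oppr_gt0 // ltr_pdivrMr // mul1r sb.
  split => //; first by lra.
  apply: (scalerI (lt0r_neq0 s0)).
  have e1 : s *: x = g a *: p a + g a' *: p a'.
    by rewrite /x scalerDr !scalerA !(mulrCA s) divff ?gt_eqF // !mulr1.
  have e2 : s *: ((1 - - g b' / - (g b + g b')) *: p b
      + (- g b' / - (g b + g b')) *: p b') = - g b *: p b + - g b' *: p b'.
    rewrite scalerDr !scalerA mulrBr -sb !(mulrCA s) divff ?gt_eqF // !mulr1 sb.
    by congr (_ *: _ + _); ring.
  rewrite e1 e2; have := dep; rewrite (sum_four un); last first.
    by move=> c /supp ->; rewrite scale0r.
  move=> e; apply/eqP; rewrite -subr_eq0 -[X in _ == X](addr0 0) -{1}e /r.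
  have z : (s + g b + g b') *: o = 0 by rewrite sb; rewrite -addrA addNr scale0r.
  rewrite -z /s; apply/eqP/colP => m; rewrite !mxE; ring.
have Tab := T_side ijk ai ai' aa'; have Tbb := T_side ijk' bi bi' bb'.
have [] := side_crossing fF (onF a _) (onF a' _) (onF b _) (onF b' _) Tab Tbb xab xcd;
  try by [rewrite gt_eqF|rewrite lt_eqF].
- by rewrite !inE => /orP[]/eqP e; move: un; rewrite /= !inE e eqxx ?orbT ?andbF.
- by rewrite !inE => /orP[]/eqP e; move: un; rewrite /= !inE e eqxx ?orbT ?andbF.
Qed.

Let T_basis i j k a b c : T i j k ->
  a \in [:: i; j; k] -> b \in [:: i; j; k] -> c \in [:: i; j; k] ->
  a != b -> b != c -> a != c -> triple (r a) (r b) (r c) != 0.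
Proof.
move=> /T_pos/lt0r_neq0 d0; rewrite !inE.
have odd x y z : triple (r x) (r y) (r z) != 0 -> triple (r y) (r x) (r z) != 0.
  by move=> h; rewrite tripleA oppr_eq0.
have rot x y z : triple (r x) (r y) (r z) != 0 -> triple (r y) (r z) (r x) != 0.
  by rewrite tripleC.
by move=> /or3P[]/eqP -> /or3P[]/eqP -> /or3P[]/eqP ->; rewrite ?eqxx // => _ _ _;
  [apply/rot/odd|apply/odd|apply/rot|apply/rot/rot|apply/odd/rot].
Qed.

(* A dependency supported on at least five vertices can be reduced, without
   creating new signs, by a dependency between four of them. *)
Let reduce_support i j k g a a' c b b' : T i j k ->
  \sum_l g l *: r l = 0 -> (forall l, 0 < g l -> l \in [:: i; j; k]) ->
  [/\ 0 < g a, 0 < g a' & 0 < g c] -> [/\ a != a', a' != c & a != c] ->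
  [/\ g b < 0, g b' < 0 & b != b'] ->
  exists g', [/\ \sum_l g' l *: r l = 0,
    (#|[set l | g' l != 0%R]%SET| < #|[set l | g l != 0%R]%SET|)%N,
    forall l, 0 < g' l -> 0 < g l, forall l, g' l < 0 -> g l < 0 &
    g' b' != 0].
Proof.
move=> ijk dep gS [ga ga' gc] [aa' a'c ac] [gb gb' bb'].
have d0 := T_basis ijk (gS _ ga) (gS _ ga') (gS _ gc) aa' a'c ac.
have ne l m : 0 < g l -> g m < 0 -> m != l.
  by move=> gl gm; apply: contraTneq gl => <-; rewrite -leNgt ltW.
have e := cramer (r a) (r a') (r c) (r b); set d := triple (r a) _ _ in d0 e.
pose x := d^-1 * triple (r a') (r c) (r b); pose y := d^-1 * triple (r c) (r a) (r b).
pose z := d^-1 * triple (r a) (r a') (r b).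
have rb : r b = x *: r a + y *: r a' + z *: r c.
  apply: (scalerI d0); rewrite e (scalerDr d (_ + _)) (scalerDr d (_ *: _)) !scalerA.
  by rewrite /x /y /z !mulVKf.
pose h l := comb3 a a' c x y z l - (l == b)%:R.
have hdep : \sum_l h l *: r l = 0.
  under eq_bigr do rewrite scalerBl.
  rewrite sumrB sum_comb3 -rb (bigD1 b) //= eqxx scale1r big1 ?addr0 ?subrr //.
  by move=> l /negbTE ->; rewrite scale0r.
have hb : h b = -1.
  by rewrite /h /comb3 eqxx !(negbTE (ne _ _ _ gb)) // !mulr0 !addr0 sub0r.
have hb' : h b' = 0.
  have b'b : (b' == b) = false by rewrite eq_sym (negbTE bb').
  by rewrite /h /comb3 b'b !(negbTE (ne _ _ _ gb')) // !mulr0 !addr0 subr0.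
have h0 l : g l = 0 -> h l = 0.
  move=> gl; have nl m : g m != 0 -> (l == m) = false.
    by move=> gm; apply/negbTE; apply: contraNneq gm => <-; apply/eqP.
  rewrite /h /comb3 (nl _ (lt0r_neq0 ga)) (nl _ (lt0r_neq0 ga')).
  by rewrite (nl _ (lt0r_neq0 gc)) (nl _ (ltr0_neq0 gb)) !mulr0 !addr0 subr0.
have bA : 0 < g b * h b by rewrite hb mulrN1 oppr_gt0.
(* The least ratio is the first step at which [g - t h] loses a coefficient, before any sign
   changes. As [h b' = 0], the coefficient at [b'] survives and keeps the reduced dependency
   nonzero. *)
have [m mA mmin] := Order.TotalTheory.arg_minP (fun l => g l / h l)
  (P := fun l => 0 < g l * h l) bA.
pose t := g m / h m.
have hm : h m != 0 by apply: contraTneq mA => ->; rewrite mulr0 ltxx.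
have t0 : 0 < t.
  have -> : t = g m * h m / (h m ^+ 2) by rewrite /t; field.
  by rewrite divr_gt0 // exprn_even_gt0.
pose g' l := g l - t * h l.
have sgn l : 0 < g l -> 0 <= g' l.
  move=> gl; rewrite subr_ge0; have [hl|hl] := ltP 0 (h l).
    by rewrite -ler_pdivlMr //; apply: mmin; rewrite mulr_gt0.
  by apply: le_trans (ltW gl); rewrite pmulr_rle0.
have sgn' l : g l < 0 -> g' l <= 0.
  move=> gl; rewrite subr_le0; have [hl|hl] := ltP (h l) 0.
    by rewrite -ler_ndivlMr //; apply: mmin; rewrite nmulr_rgt0.
  by apply: le_trans (ltW gl) _; rewrite pmulr_rge0.
have z0 l : g l = 0 -> g' l = 0 by move=> gl; rewrite /g' gl h0 // mulr0 subr0.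
exists g'; split.
- rewrite (eq_bigr (fun l => g l *: r l - t *: (h l *: r l))) => [|l _].
    by rewrite sumrB -scaler_sumr dep hdep scaler0 subr0.
  by rewrite scalerBl scalerA.
- apply: proper_card; apply/properP; split.
    by apply/fintype.subsetP => l; rewrite !inE; apply: contraNneq => /z0 ->.
  exists m; rewrite !inE; first by apply: contraTneq mA => ->; rewrite mul0r ltxx.
  by rewrite negbK /g' /t divfK // subrr.
- move=> l; apply: contraTT; rewrite -!leNgt le_eqVlt => /orP[/eqP/z0 ->//|].
  exact: sgn'.
- move=> l; apply: contraTT; rewrite -!leNgt le_eqVlt => /orP[/eqP/esym/z0 ->//|].
  exact: sgn.
- by rewrite /g' hb' mulr0 subr0 lt_eqF.
Qed.

(* In a dependency of minimal support two points lie on each side, and their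
   segments cross, which the subdivision excludes. *)
Let T_fan i j k i' j' k' g : T i j k -> T i' j' k' ->
  \sum_a g a *: r a = 0 ->
  (forall a, 0 < g a -> a \in [:: i; j; k]) ->
  (forall a, g a < 0 -> a \in [:: i'; j'; k']) -> forall a, g a = 0.
Proof.
move: {2}(#|_|.+1) (ltnSn #|[set l | g l != 0%R]%SET|) => N.
elim: N i j k i' j' k' g => // N IH i j k i' j' k' g.
rewrite ltnS => gN ijk ijk' dep gS gS'.
have [F [w [_ wP _ wS]]] := T_facet ijk; have [F' [w' [_ wP' _ wS']]] := T_facet ijk'.
have Ndep : \sum_a - g a *: r a = 0.
  by under eq_bigr do rewrite scaleNr; rewrite sumrN dep oppr0.
have NS a : 0 < - g a -> a \in [:: i'; j'; k'] by rewrite oppr_gt0; exact: gS'.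
have NS' a : - g a < 0 -> a \in [:: i; j; k] by rewrite oppr_lt0; exact: gS.
(* The supporting planes of the two triangles bound the total of [g] by 0 from above and from below.
   With total zero, each sign occurs at least twice. *)
have [b1 _] := face_balance dep (fun a => wP _ (p_in_P a)) wS gS.
have [b2 _] := face_balance Ndep (fun a => wP' _ (p_in_P a)) wS' NS.
have g0 : \sum_a g a = 0 by move: b2; rewrite sumrN; lra.
have Ng0 : \sum_a - g a = 0 by rewrite sumrN g0 oppr0.
have ex_pos f : \sum_a f a = 0 -> (exists a, f a < 0) -> exists a, 0 < f a :> R.
  move=> f0 [a fa]; apply: contrapT => none.
  have f_le b : 0 <= - f b.
    by rewrite oppr_ge0 leNgt; apply/negP => ?; apply: none; exists b.
  have Nf0 : \sum_b - f b = 0 by rewrite sumrN f0 oppr0.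
  have := psumr_eq0P (fun b (_ : xpredT b) => f_le b) Nf0 (i := a) isT; lra.
apply: contrapT => nz.
have [a ga] : exists a, 0 < g a.
  apply: contrapT => npos; apply: nz => a; apply/eqP; rewrite eq_le !leNgt.
  apply/andP; split; apply/negP => ga; apply: npos; first by exists a.
  by apply: ex_pos => //; exists a.
have [a' a'a ga'] := other_positive dep g0 ga.
have [b gb] : exists b, 0 < - g b by apply: ex_pos => //; exists a; rewrite oppr_lt0.
have [b' b'b gb'] := other_positive Ndep Ng0 gb.
rewrite !oppr_gt0 in gb gb'.
have [[c [cne gc]]|only] :=
  pselect (exists c, c \notin [:: a; a'; b; b'] /\ g c != 0); last first.
  apply: (no_crossing (a := a) (a' := a') (b := b) (b' := b') ijk ijk' dep g0).
  - by split=> //; [exact: gS|exact: gS|rewrite eq_sym].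
  - by split=> //; [exact: gS'|exact: gS'|rewrite eq_sym].
  - move=> G v _ vP vS.
    by have [_ /(_ g0)] := face_balance dep (fun a => vP _ (p_in_P a)) vS gS.
  - by move=> c cn; apply/eqP/negPn/negP => gc; apply: only; exists c.
move: cne; rewrite !inE !negb_or => /and4P[ca ca' cb cb'].
have [gc0|gc0|/esym/eqP] := ltrgtP 0 (g c); last by rewrite (negbTE gc).
- have [g' [dep' card' pos' neg' nz']] : exists g', [/\ \sum_l g' l *: r l = 0,
      (#|[set l | g' l != 0%R]%SET| < #|[set l | g l != 0%R]%SET|)%N,
      forall l, 0 < g' l -> 0 < g l, forall l, g' l < 0 -> g l < 0 & g' b' != 0].
    apply: (reduce_support (a := a) (a' := a') (c := c) (b := b) ijk dep gS) => //.
    by split; rewrite eq_sym.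
    by split=> //; rewrite eq_sym.
  have /eqP := IH i j k i' j' k' g' (leq_trans card' gN) ijk ijk' dep'
    (fun l gl => gS l (pos' l gl)) (fun l gl => gS' l (neg' l gl)) b'.
  by rewrite (negbTE nz').
(* A fifth vertex on the negative side: the same reduction applies to [- g] with the triangles
   exchanged. *)
- have [g' [dep' card' pos' neg' nz']] : exists g', [/\ \sum_l g' l *: r l = 0,
      (#|[set l | g' l != 0%R]%SET| < #|[set l | - g l != 0%R]%SET|)%N,
      forall l, 0 < g' l -> 0 < - g l, forall l, g' l < 0 -> - g l < 0 & g' a' != 0].
    apply: (reduce_support (a := b) (a' := b') (c := c) (b := a) ijk' Ndep NS).
    - by rewrite !oppr_gt0.
    - by split; rewrite eq_sym.
    - by rewrite !oppr_lt0; split=> //; rewrite eq_sym.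
  have cardN : #|[set l | - g l != 0%R]%SET| = #|[set l | g l != 0%R]%SET|.
    by apply: eq_card => l; rewrite !inE oppr_eq0.
  rewrite cardN in card'.
  have /eqP := IH i' j' k' i j k g' (leq_trans card' gN) ijk' ijk dep'
    (fun l gl => NS l (pos' l gl)) (fun l gl => NS' l (neg' l gl)) a'.
  by rewrite (negbTE nz').
Qed.

(** * Motions of facet triangles *)

Variable q : 'I_n -> V.
Hypothesis q_isometric : forall i j, side i j -> dot (p i - p j) (q i - q j) = 0.

Let T_isometric i j k : T i j k -> dot (r i - r j) (q i - q j) = 0.
Proof.
move=> ijk; have -> : r i - r j = p i - p j by rewrite /r opprB addrA subrK.
apply: q_isometric; have /asboolP[_ [F [_ _ []]]] // := ijk.
Qed.

Let N_triple i j k w : dot w (r i) = 1 -> dot w (r j) = 1 -> dot w (r k) = 1 ->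
  cross (p j - p i) (p k - p i) = triple (r i) (r j) (r k) *: w.
Proof.
move=> wi wj wk; rewrite (cramer_dual _ _ _ w) wi wj wk !scale1r /r.
by vecring.
Qed.

(** Independent of [o], unlike [T], so that one triangle can be used with every interior origin. *)
Definition facet_triangle i j k := noncollinear (p i) (p j) (p k) /\
  exists2 F, is_facet P F & [/\ F (p i), F (p j) & F (p k)].

Lemma vertex_motion i : exists j k w v, facet_triangle i j k /\
  [/\ q i = cross w (p i) + v, q j = cross w (p j) + v & q k = cross w (p k) + v].
Proof.
have [j [k ijk]] := vertex_triangle T_cyc T_pos T_cover T_face r_exposed i.
have [w [v [qi qj qk]]] := triangle_motion T_cyc T_pos T_isometric ijk.
exists j, k, w, (v - cross w o); split.
  split; last by have /asboolP[_ [F [fF FF _]]] := ijk; exists F.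
  have [u [ui uj uk _]] := T_face ijk.
  apply/noncollinearP; rewrite (N_triple ui uj uk) scaler_eq0 (gt_eqF (T_pos ijk)) /=.
  by apply: contra_eqN ui => /eqP ->; rewrite dot0l eq_sym oner_eq0.
have E a : cross w (r a) + v = cross w (p a) + (v - cross w o).
  by rewrite /r; vecring.
by rewrite -!E.
Qed.

(** Only the velocity at [o], [cross w o + v], contributes to [dot (q a) (r a)]. The plane of a
    facet misses [o], so the three vectors [r a] form a basis and identify it with the vector of
    [radial_linear]. *)
Lemma origin_velocity : exists u, forall i j k w v, facet_triangle i j k ->
  q i = cross w (p i) + v -> q j = cross w (p j) + v -> q k = cross w (p k) + v ->
  cross w o + v = u.
Proof.
have [u uE] := radial_linear T_cyc T_pos T_cover T_fan T_face r_exposed T_isometric.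
exists u => i j k w v [/noncollinearP nc [F fF [Fi Fj Fk]]] qi qj qk.
have [x [_ xE]] := face_functional o_interior fF.1.
have /xE[_ xi] := Fi; have /xE[_ xj] := Fj; have /xE[_ xk] := Fk.
move: nc; rewrite (N_triple xi xj xk) scaler_eq0 negb_or => /andP[d0 _].
have E a : q a = cross w (p a) + v -> dot (cross w o + v) (r a) = dot u (r a).
  by move=> qa; rewrite -uE qa /r; vring.
by apply: (basis_ext d0); apply: E.
Qed.

End Polyhedron.

(** * From edge derivatives to skew matrices, and rigidity *)

Section Rigidity.
Variable R : realType.
Local Notation V := 'cV[R]_3.

(* Squaring [enorm] turns the condition into the vanishing of the linear
   coefficient of a quadratic polynomial. *)
Lemma isometric_edge (x y : V) :
  is_derive (0 : R) (1 : R) (fun t : R => enorm (x + t *: y)) 0 -> dot x y = 0.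
Proof.
move=> h.
have h2 : is_derive (0 : R) (1 : R) (fun t : R => enorm (x + t *: y) ^+ 2) 0.
  by apply: is_derive_eq (is_deriveX 2 h) _; rewrite scaler0.
have E : (fun t : R => enorm (x + t *: y) ^+ 2) =
    (fun t => dot x x + t * (2 * dot x y) + t ^+ 2 * dot y y).
  apply: funext => t; rewrite /enorm sqr_sqrtr ?dot_ge0 //.
  by vring.
have h3 : is_derive (0 : R) (1 : R)
    (fun t : R => dot x x + t * (2 * dot x y) + t ^+ 2 * dot y y) (2 * dot x y).
  apply: is_derive_eq; rewrite /GRing.scale /=; ring.
rewrite E in h2; have [_ e2] := h2; have [_ e3] := h3.
by move: e2; rewrite e3; lra.
Qed.

Lemma cross_matrix (w : V) : exists A : 'M[R]_3,
  A^T = - A /\ forall x, A *m x = cross w x.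
Proof.
exists (\matrix_(i, j) cross w (delta_mx j 0) i 0); split.
  apply/matrixP => -[[|[|[|//]]] hi] [[|[|[|//]]] hj]; rewrite ?mxE /= ?mxE /=; ring.
move=> x; apply/colP => i; rewrite mxE.
have -> : cross w x = \sum_j x j 0 *: cross w (delta_mx j 0).
  apply/dot_ext => z; rewrite dot_suml.
  have dd j v : dot (delta_mx j 0 : V) v = v j 0.
    rewrite /dot (bigD1 j) //= mxE !eqxx mul1r big1 ?addr0 // => k /negbTE kj.
    by rewrite mxE kj mul0r.
  have tr y : dot (cross w y) z = dot y (cross z w) by vring.
  by rewrite tr; apply: eq_bigr => j _; rewrite dotZl tr dd.
by rewrite summxE; apply: eq_bigr => j _; rewrite !mxE mulrC.
Qed.

End Rigidity.

Theorem theorem3p4 (R : realType) (P : set 'cV[R]_3)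
    (n : nat) (p : 'I_n -> 'cV[R]_3) (D : rel 'I_n)
    (P_polyhedron : convex_polyhedron P) (P_compact : compact P)
    (P_interior : interior P !=set0)
    (p_vertices : enumerates_vertices P p)
    (D_subdivision : subdivides_faces P p D) :
  infinitesimally_rigid P p D.
Proof.
move=> q q_iso.
have q_edge i j : is_edge P (p i) (p j) \/ D i j ->
    dot (p i - p j) (q i - q j) = 0.
  move=> /q_iso h; apply: isometric_edge.
  have -> : (fun t : R => enorm (p i - p j + t *: (q i - q j))) =
      (fun t => enorm ((p i + t *: q i) - (p j + t *: q j))) => //.
  by apply: funext => t; congr enorm; apply/colP => m; rewrite !mxE; ring.
have [[i0 _]|none] := pselect (exists i : 'I_n, True); last first.
  by exists 0, 0; split=> [|i]; [rewrite trmx0 oppr0|case: none; exists i].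
have [] := P_interior => o oP.
have motion := vertex_motion P_polyhedron P_compact oP p_vertices D_subdivision q_edge.
have velocity o' : interior P o' -> _ := fun o'P =>
  origin_velocity P_polyhedron P_compact o'P p_vertices D_subdivision q_edge.
have [j0 [k0 [w [v [T0 [qi0 qj0 qk0]]]]]] := motion i0.
have [A [AT Aw]] := cross_matrix w.
exists A, v; split=> // i; rewrite Aw.
have [j [k [w' [v' [Ti [qi qj qk]]]]]] := motion i.
(* Both motions give every interior point the same velocity; comparing [o] with a nearby
   [o + s *: x], for arbitrary [x], isolates the rotation. *)
have same o' : interior P o' -> cross w' o' + v' = cross w o' + v.
  move=> /velocity[u uE].
  by rewrite (uE _ _ _ _ _ T0 qi0 qj0 qk0) (uE _ _ _ _ _ Ti qi qj qk).
have ww' x : cross (w' - w) x = 0.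
  have [s s0 /same so] := nbhs_direction x (nbhs_interior oP).
  apply: (scalerI (lt0r_neq0 s0)); rewrite scaler0.
  have -> : s *: cross (w' - w) x =
    (cross w' (o + s *: x) + v' - (cross w (o + s *: x) + v))
    - (cross w' o + v' - (cross w o + v)) by vecring.
  by rewrite so (same _ oP) !subrr.
have [/noncollinearP nc _] := Ti.
have w'w : w' = w.
  by apply/eqP; rewrite -subr_eq0; apply/eqP; apply: (cross_pair_eq0 nc).
have v'v : v' = v by have := same _ oP; rewrite w'w => /addrI.
by rewrite qi w'w v'v.
Qed.
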